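(* Let $(M,J,\Omega)$ be a compact $p$-Kähler manifold of complex dimension $n$, with $1<p<n-1$, and let $\{M_t\}_{t\in I}$ be a differentiable family of compact complex manifolds, where $I=(-\epsilon,\epsilon)$, $\epsilon>0$, and $M_0=(M,J)$. Suppose that $\{M_t\}_{t\in I}$ is parametrized by the $(0,1)$-vector form $\varphi(t)\in\mathcal{A}^{0,1}(T^{1,0}M)$. Let $\{\Omega_t\}_{t\in I}$ be a smooth family of real transverse $(p,p)$-forms along $\{M_t\}_{t\in I}$ (i.e. $\Omega_t$ is a real transverse $(p,p)$-form on $M_t$) with $\Omega_0=\Omega$, written as $$\Omega_t=e^{\iota_{\varphi(t)}|\iota_{\overline{\varphi(t)}}}\big(\Omega(t)\big),\qquad \Omega(t)\in\mathcal{A}^{p,p}(M).$$ If every $\Omega_t$ is a $p$-Kähler structure on $M_t$, then $$\partial\big(\iota_{\varphi'(0)}(\Omega)\big)=-\,\overline{\partial}\,\Omega'(0),$$ where $\varphi'(0)$ and $\Omega'(0)$ denote the derivatives at $t=0$ of $\varphi(t)$ and $\Omega(t)$, and $\partial,\overline{\partial}$ are the operators of $(M,J)$.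
   Context: $p$-Kähler structures. Let $\sigma_{q}=i^{q^{2}}2^{-q}$. At a point $x$ of a complex manifold of complex dimension $n$, given a basis $\{\varphi^1,\dots,\varphi^n\}$ of $(1,0)$-covectors, put $\mathrm{Vol}=(\tfrac{i}{2}\varphi^1\wedge\overline{\varphi}^1)\wedge\dots\wedge(\tfrac{i}{2}\varphi^n\wedge\overline{\varphi}^n)$; a real $(n,n)$-form at $x$ is strictly positive if it is a positive multiple of $\mathrm{Vol}$. A $(q,0)$-covector is simple if it is a wedge product of $q$ $(1,0)$-covectors. A real $(p,p)$-form $\Omega$ is transverse if at every point $\sigma_{n-p}\,\Omega\wedge\beta\wedge\overline{\beta}$ is strictly positive for every nonzero simple $(n-p,0)$-covector $\beta$. A $p$-Kähler structure is a smooth real transverse $(p,p)$-form with $d\Omega=0$; $(M,J,\Omega)$ is then called a $p$-Kähler manifold. Deformations. A differentiable family of compact complex manifolds $\{M_t\}_{t\in I}$ is given by a differentiable manifold $\mathfrak{M}$ and a differentiable proper map $\pi:\mathfrak{M}\to I$ whose Jacobian has constant rank equal to $\dim I=1$, with $\pi^{-1}(t)=M_t$ as complex manifolds. All $M_t$ are diffeomorphic, so one regards $M_t$ as the fixed smooth manifold $M$ with a complex structure $J_t$, $J_0=J$. $\mathcal{A}^{p,q}(M)$ denotes smooth $(p,q)$-forms on $(M,J)$ and $\mathcal{A}^{0,1}(T^{1,0}M)$ the smooth $T^{1,0}M$-valued $(0,1)$-forms. The family is parametrized by $\varphi(t)\in\mathcal{A}^{0,1}(T^{1,0}M)$ (depending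 smoothly on $t$, $\varphi(0)=0$, satisfying the Maurer–Cartan equation $\overline{\partial}\varphi(t)=\tfrac12[\varphi(t),\varphi(t)]$), which means: writing locally $\varphi(t)=\sum_{\lambda}\varphi^{\lambda}(t)\otimes\frac{\partial}{\partial z^{\lambda}}$ in local holomorphic coordinates of $(M,J)$, a differentiable function $f$ on an open subset of $M$ is holomorphic for $M_t$ if and only if $\big(\overline{\partial}-\sum_\lambda\varphi^{\lambda}(t)\frac{\partial}{\partial z^{\lambda}}\big)f=0$. Contraction and extension map. For a vector form $\phi=\eta\otimes Z$, with $\eta\in\mathcal{A}^{0,s}(M)$ and $Z$ a section of $T^{1,0}M$, set $\iota_\phi(\sigma)=\eta\wedge(\iota_Z\sigma)$, extended linearly, so that $\iota_\phi:\mathcal{A}^{p,q}(M)\to\mathcal{A}^{p-1,q+s}(M)$; the contraction by the conjugate $\overline{\varphi(t)}$ is defined analogously. Put $e^{\iota_{\varphi(t)}}=\sum_{k\ge0}\frac{1}{k!}\iota_{\varphi(t)}^k$ and similarly $e^{\iota_{\overline{\varphi(t)}}}$. The map $e^{\iota_{\varphi(t)}|\iota_{\overline{\varphi(t)}}}:\mathcal{A}^{p,q}(M)\to\mathcal{A}^{p,q}(M_t)$ sends a form locally written $\sum\sigma_{i_1\dots i_pj_1\dots j_q}dz^{i_1}\wedge\dots\wedge dz^{i_p}\wedge d\overline{z}^{j_1}\wedge\dots\wedge d\overline{z}^{j_q}$ to $$\sum\sigma_{i_1\dots i_pj_1\dots j_q}\,e^{\iota_{\varphi(t)}}(dz^{i_1}\wedge\dots\wedge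 dz^{i_p})\wedge e^{\iota_{\overline{\varphi(t)}}}(d\overline{z}^{j_1}\wedge\dots\wedge d\overline{z}^{j_q}).$$ It is a linear isomorphism for $t$ small, so a smooth family of $(p,p)$-forms along $\{M_t\}$ can be written as $\Omega_t=e^{\iota_{\varphi(t)}|\iota_{\overline{\varphi(t)}}}(\Omega(t))$ with $\Omega(t)\in\mathcal{A}^{p,p}(M)$ depending smoothly on $t$; in particular $\Omega(0)=\Omega_0$. *)

(* Defs.v *)
From HB Require Import structures.
From mathcomp Require Import all_boot all_order all_algebra.
From mathcomp Require Import complex.
From mathcomp Require Import all_classical all_reals all_analysis.

Set Implicit Arguments.
Unset Strict Implicit.
Unset Printing Implicit Defensive.

Import Order.TTheory GRing.Theory Num.Theory.
Import numFieldNormedType.Exports.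

Local Open Scope ring_scope.

(** C^n is R^(n+n) with coordinates (x_1, .., x_n, y_1, .., y_n) and
    z_j = x_j + i y_j. *)

Definition partial (R : realType) (m : nat) (i : 'I_m) (f : 'rV[R]_m -> R) :
  'rV[R]_m -> R := fun u => 'D_(delta_mx 0 i) f u.

Definition smooth_on (R : realType) (m : nat) (U : set 'rV[R]_m)
    (f : 'rV[R]_m -> R) : Prop :=
  forall (s : seq 'I_m) (u : 'rV[R]_m), U u ->
    let g := foldr (@partial R m) f s in
    {for u, continuous g} /\ forall i, derivable g u (delta_mx 0 i).

Definition smoothC_on (R : realType) (m : nat) (U : set 'rV[R]_m)
    (f : 'rV[R]_m -> R[i]) : Prop :=
  smooth_on U (fun u => complex.Re (f u)) /\
  smooth_on U (fun u => complex.Im (f u)).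

Definition smooth_map_on (R : realType) (m k : nat) (U : set 'rV[R]_m)
    (f : 'rV[R]_m -> 'rV[R]_k) : Prop :=
  forall j : 'I_k, smooth_on U (fun u => f u 0 j).

Definition partialC (R : realType) (m : nat) (i : 'I_m) (f : 'rV[R]_m -> R[i])
    (u : 'rV[R]_m) : R[i] :=
  Complex (partial i (fun v => complex.Re (f v)) u)
          (partial i (fun v => complex.Im (f v)) u).

Definition imagC (R : realType) : R[i] := Complex 0 1.

Definition zcoord (R : realType) (n : nat) (j : 'I_n) (u : 'rV[R]_(n + n)) :
  R[i] := Complex (u 0 (lshift n j)) (u 0 (rshift n j)).

Definition d_z (R : realType) (n : nat) (j : 'I_n)
    (f : 'rV[R]_(n + n) -> R[i]) (u : 'rV[R]_(n + n)) : R[i] :=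
  2^-1 * (partialC (lshift n j) f u - imagC R * partialC (rshift n j) f u).

Definition d_zbar (R : realType) (n : nat) (j : 'I_n)
    (f : 'rV[R]_(n + n) -> R[i]) (u : 'rV[R]_(n + n)) : R[i] :=
  2^-1 * (partialC (lshift n j) f u + imagC R * partialC (rshift n j) f u).

Definition holomorphic_on (R : realType) (n : nat) (U : set 'rV[R]_(n + n))
    (f : 'rV[R]_(n + n) -> R[i]) : Prop :=
  smoothC_on U f /\ forall u, U u -> forall j, d_zbar j f u = 0.

Definition holomorphic_map_on (R : realType) (n : nat)
    (U : set 'rV[R]_(n + n)) (f : 'rV[R]_(n + n) -> 'rV[R]_(n + n)) : Prop :=
  forall j : 'I_n, holomorphic_on U (fun u => zcoord j (f u)).

(** [ext R m] is the complex exterior algebra on generators e_0, .., e_(m-1);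
    the value at [S] is the coefficient of the product of the e_s, [s] in [S],
    taken in increasing order. *)

Notation ext R m := {ffun {set 'I_m} -> R[i]^o}.

Definition ebasis {R : realType} {m : nat} (S : {set 'I_m}) : ext R m :=
  [ffun T => (T == S)%:R].

Definition shuffle_sign (R : realType) (m : nat) (A B : {set 'I_m}) : R[i] :=
  (-1) ^+ #|[set ij : 'I_m * 'I_m |
             [&& ij.1 \in A, ij.2 \in B & (ij.2 < ij.1)%N]]|.

Definition wedge {R : realType} {m : nat} (a b : ext R m) : ext R m :=
  [ffun S : {set 'I_m} => \sum_(A : {set 'I_m} | A \subset S)
     shuffle_sign R A (S :\: A) * a A * b (S :\: A)].

(** Interior product with the dual basis vector of e_s. *)
Definition interior_prod {R : realType} {m : nat} (s : 'I_m) (a : ext R m) :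
    ext R m :=
  [ffun S : {set 'I_m} => if s \in S then 0
     else (-1) ^+ #|[set j in S | (j < s)%N]| * a (s |: S)].

(** The algebra morphism sending e_s to [L s]. *)
Definition ext_morph {R : realType} {m k : nat} (L : 'I_m -> ext R k)
    (a : ext R m) : ext R k :=
  \sum_(S : {set 'I_m})
     a S *: \big[wedge/ebasis finset.set0]_(s <- enum S) L s.

(** On C^n the generators are (dz_1, .., dz_n, dzbar_1, .., dzbar_n). *)
Definition dz (R : realType) (n : nat) (j : 'I_n) : ext R (n + n) :=
  ebasis (finset.set1 (lshift n j)).
Definition dzbar (R : realType) (n : nat) (j : 'I_n) : ext R (n + n) :=
  ebasis (finset.set1 (rshift n j)).

Definition dz_indices (n : nat) : {set 'I_(n + n)} :=
  [set lshift n j | j in 'I_n]%SET.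

Definition has_type {R : realType} {n : nat} (p q : nat)
    (a : ext R (n + n)) : Prop :=
  forall S : {set 'I_(n + n)}, a S != 0 ->
    #|(S :&: dz_indices n)%SET| = p /\ #|(S :\: dz_indices n)%SET| = q.

Definition ext_conj {R : realType} {n : nat} (a : ext R (n + n)) :
    ext R (n + n) :=
  ext_morph (fun s : 'I_(n + n) => match fintype.split s with
                      | inl j => dzbar R j
                      | inr j => dz R j
                      end)
            [ffun S => conjc (a S)].

(** The matrix [A] stands for sum_(l, k) A l k dzbar_k (x) d/dz_l. *)

Definition vcomp {R : realType} {n : nat} (A : 'M[R[i]]_n) (l : 'I_n) :
  ext R (n + n) := \sum_k (A l k : R[i]) *: dzbar R k.

Definition iota_v {R : realType} {n : nat} (A : 'M[R[i]]_n)
    (a : ext R (n + n)) : ext R (n + n) :=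
  \sum_l wedge (vcomp A l) (interior_prod (lshift n l) a).

Definition iota_vbar {R : realType} {n : nat} (A : 'M[R[i]]_n)
    (a : ext R (n + n)) : ext R (n + n) :=
  \sum_l wedge (\sum_k (conjc (A l k) : R[i]) *: dz R k)
               (interior_prod (rshift n l) a).

(** Both contractions lower by 1 the number of dz's (resp. dzbar's), so their
    (n+1)-st powers vanish and the exponential series is the sum below. *)
Definition exp_nilp {R : realType} {n : nat}
    (f : ext R (n + n) -> ext R (n + n)) (a : ext R (n + n)) : ext R (n + n) :=
  \sum_(k < n.+1) ((k`!)%:R^-1 : R[i]) *: iter k f a.

Definition ext_exp {R : realType} {n : nat} (A : 'M[R[i]]_n)
    (a : ext R (n + n)) : ext R (n + n) :=
  \sum_(S : {set 'I_(n + n)}) a S *: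
    wedge (exp_nilp (iota_v A) (ebasis (S :&: dz_indices n)%SET))
          (exp_nilp (iota_vbar A) (ebasis (S :\: dz_indices n)%SET)).

Definition sigma_ (R : realType) (q : nat) : R[i] :=
  imagC R ^+ (q ^ 2) * 2 ^- q.

Definition Vol (R : realType) (n : nat) : ext R (n + n) :=
  \big[wedge/ebasis finset.set0]_(j < n)
     ((imagC R / 2) *: wedge (dz R j) (dzbar R j)).

Definition strictly_positive {R : realType} {n : nat} (a : ext R (n + n)) :
  Prop := exists c : R, 0 < c /\ a = (Complex c 0 : R[i]) *: Vol R n.

Definition simple_covector {R : realType} {n : nat} (q : nat)
    (b : ext R (n + n)) : Prop :=
  exists B : 'M[R[i]]_(q, n),
    b = \big[wedge/ebasis finset.set0]_(k < q)
          (\sum_j (B k j : R[i]) *: dz R j).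

Definition transverse_covector {R : realType} {n : nat} (p : nat)
    (a : ext R (n + n)) : Prop :=
  forall b, simple_covector (n - p) b -> b != 0 ->
    strictly_positive (sigma_ R (n - p) *: wedge (wedge a b) (ext_conj b)).

Definition dcoef {R : realType} {n : nat}
    (D : ('rV[R]_(n + n) -> R[i]) -> 'rV[R]_(n + n) -> R[i])
    (w : 'rV[R]_(n + n) -> ext R (n + n)) (u : 'rV[R]_(n + n)) :
  ext R (n + n) := [ffun S => D (fun v => w v S) u].

Definition del {R : realType} {n : nat}
    (w : 'rV[R]_(n + n) -> ext R (n + n)) (u : 'rV[R]_(n + n)) :
  ext R (n + n) := \sum_j wedge (dz R j) (dcoef (d_z j) w u).

Definition delbar {R : realType} {n : nat}
    (w : 'rV[R]_(n + n) -> ext R (n + n)) (u : 'rV[R]_(n + n)) :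
  ext R (n + n) := \sum_j wedge (dzbar R j) (dcoef (d_zbar j) w u).

(** The exterior derivative; the formula is valid in every smooth chart, with
    dz_j = dx_j + i dy_j. *)
Definition ext_d {R : realType} {n : nat}
    (w : 'rV[R]_(n + n) -> ext R (n + n)) (u : 'rV[R]_(n + n)) :
  ext R (n + n) := del w u + delbar w u.

Definition dfun {R : realType} {n : nat} (f : 'rV[R]_(n + n) -> R[i])
    (u : 'rV[R]_(n + n)) : ext R (n + n) :=
  \sum_j (d_z j f u *: dz R j + d_zbar j f u *: dzbar R j).

(** Pull-back at [u] by [tau] of a covector at [tau u]. *)
Definition ext_pull {R : realType} {n : nat}
    (tau : 'rV[R]_(n + n) -> 'rV[R]_(n + n)) (u : 'rV[R]_(n + n)) :
    ext R (n + n) -> ext R (n + n) :=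
  ext_morph (fun s : 'I_(n + n) => match fintype.split s with
    | inl j => dfun (fun v => zcoord j (tau v)) u
    | inr j => dfun (fun v => conjc (zcoord j (tau v))) u
    end).

Local Open Scope classical_set_scope.

Record chart (R : realType) (T : Type) (m : nat) := Chart {
  cdom : set T;
  cmap : T -> 'rV[R]_m;
  cinv : 'rV[R]_m -> T
}.

Definition cimg (R : realType) (T : Type) (m : nat) (c : chart R T m) :
  set 'rV[R]_m := cmap c @` cdom c.

Definition overlap (R : realType) (T : Type) (m : nat) (c d : chart R T m) :
  set 'rV[R]_m := cmap c @` (cdom c `&` cdom d).

Definition trans (R : realType) (T : Type) (m : nat) (c d : chart R T m) :
  'rV[R]_m -> 'rV[R]_m := fun u => cmap d (cinv c u).

Definition is_chart (R : realType) (T : topologicalType) (m : nat)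
    (c : chart R T m) : Prop :=
  [/\ open (cdom c), open (cimg c),
      forall x, cdom c x -> cinv c (cmap c x) = x,
      forall x, cdom c x -> {for x, continuous (cmap c)} &
      forall u, cimg c u -> {for u, continuous (cinv c)}].

Record manifold (R : realType) (m : nat) := Manifold {
  mcar :> topologicalType;
  atlas : set (chart R mcar m);
  m_hausdorff : hausdorff_space mcar;
  m_countable : @second_countable mcar;
  m_chart : forall c, atlas c -> is_chart c;
  m_cover : forall x, exists c, atlas c /\ cdom c x;
  m_compat : forall c d, atlas c -> atlas d ->
    smooth_map_on (overlap c d) (trans c d)
}.

Record cmanifold (R : realType) (n : nat) := CManifold {
  cm_manifold :> manifold R (n + n);
  cm_hol : forall c d : chart R cm_manifold (n + n), atlas c -> atlas d ->
    holomorphic_map_on (overlap c d) (trans c d)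
}.

Definition smooth_chart (R : realType) (m : nat) (X : manifold R m)
    (c : chart R X m) : Prop :=
  is_chart c /\ forall d, atlas d ->
    smooth_map_on (overlap c d) (trans c d) /\
    smooth_map_on (overlap d c) (trans d c).

Definition hol_chart (R : realType) (n : nat) (X : cmanifold R n)
    (c : chart R X (n + n)) : Prop :=
  is_chart c /\ forall d, atlas d ->
    holomorphic_map_on (overlap c d) (trans c d) /\
    holomorphic_map_on (overlap d c) (trans d c).

Definition smooth_map (R : realType) (m k : nat) (X : manifold R m)
    (Y : manifold R k) (f : X -> Y) : Prop :=
  continuous f /\
  forall (c : chart R X m) (d : chart R Y k), atlas c -> atlas d ->
    smooth_map_on (cmap c @` (cdom c `&` f @^-1` cdom d))
                  (fun u => cmap d (f (cinv c u))).

Definition holomorphic_map (R : realType) (n : nat) (X Y : cmanifold R n)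
    (f : X -> Y) : Prop :=
  continuous f /\
  forall (c : chart R X (n + n)) (d : chart R Y (n + n)),
    atlas c -> atlas d ->
    holomorphic_map_on (cmap c @` (cdom c `&` f @^-1` cdom d))
                       (fun u => cmap d (f (cinv c u))).

Definition smooth_fun (R : realType) (n : nat) (X : cmanifold R n)
    (W : set X) (f : X -> R[i]) : Prop :=
  forall c : chart R X (n + n), atlas c ->
    smoothC_on (cmap c @` (cdom c `&` W)) (fun u => f (cinv c u)).

Definition holomorphic_fun (R : realType) (n : nat) (X : cmanifold R n)
    (W : set X) (f : X -> R[i]) : Prop :=
  forall c : chart R X (n + n), atlas c ->
    holomorphic_on (cmap c @` (cdom c `&` W)) (fun u => f (cinv c u)).

(** A form on [X] is given by its expression in every smooth chart [c], a
    function on [cimg c]; expressions in two charts correspond under pull-back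
    by the change of coordinates.  Values off [cimg c], or at a [c] which is
    not a smooth chart, are meaningless. *)

Definition preform (R : realType) (n : nat) (X : cmanifold R n) : Type :=
  chart R X (n + n) -> 'rV[R]_(n + n) -> ext R (n + n).

Definition form_eq (R : realType) (n : nat) (X : cmanifold R n)
    (w w' : preform X) : Prop :=
  forall c, smooth_chart c -> forall u, cimg c u -> w c u = w' c u.

Definition is_form (R : realType) (n : nat) (X : cmanifold R n)
    (w : preform X) : Prop :=
  (forall c, smooth_chart c -> forall S, smoothC_on (cimg c) (fun u => w c u S))
  /\
  (forall c d, smooth_chart c -> smooth_chart d ->
     forall u, overlap c d u ->
       w c u = ext_pull (trans c d) u (w d (trans c d u))).

Definition pq_form (R : realType) (n p q : nat) (X : cmanifold R n)
    (w : preform X) : Prop :=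
  is_form w /\
  forall c, hol_chart c -> forall u, cimg c u -> has_type p q (w c u).

Definition real_form (R : realType) (n : nat) (X : cmanifold R n)
    (w : preform X) : Prop := form_eq (fun c u => ext_conj (w c u)) w.

Definition transverse (R : realType) (n p : nat) (X : cmanifold R n)
    (w : preform X) : Prop :=
  forall c, hol_chart c -> forall u, cimg c u -> transverse_covector p (w c u).

Definition real_transverse_form (R : realType) (n p : nat)
    (X : cmanifold R n) (w : preform X) : Prop :=
  [/\ pq_form p p w, real_form w & transverse p w].

Definition closed_form (R : realType) (n : nat) (X : cmanifold R n)
    (w : preform X) : Prop := form_eq (fun c => ext_d (w c)) (fun _ _ => 0).

Definition p_kahler (R : realType) (n p : nat) (X : cmanifold R n)
    (w : preform X) : Prop :=
  real_transverse_form p w /\ closed_form w.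

(** Pull-back along a diffeomorphism [F] with inverse [G]: its expression in
    the chart [c] of the source is the expression of the given form in the chart
    [c o G] of the target. *)
Definition push_chart (R : realType) (T T' : Type) (m : nat)
    (F : T -> T') (G : T' -> T) (c : chart R T m) : chart R T' m :=
  Chart (F @` cdom c) (fun y => cmap c (G y)) (fun u => F (cinv c u)).

Definition pullback (R : realType) (n : nat) (X Y : cmanifold R n)
    (F : X -> Y) (G : Y -> X) (w : preform Y) : preform X :=
  fun c => w (push_chart F G c).

Definition base (R : realType) (eps : R) : set R := [set t | - eps < t < eps].

Definition base_img (R : realType) (T : Type) (m : nat) (eps : R)
    (c : chart R T m) : set 'rV[R]_(1 + m) :=
  [set v | base eps (lsubmx v 0 0) /\ cimg c (rsubmx v)].

Record dfamily (R : realType) (n : nat) (eps : R) := DFamily {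
  total : manifold R (1 + (n + n));
  proj : total -> R;
  proj_base : forall y, base eps (proj y);
  proj_smooth : forall c : chart R total (1 + (n + n)), atlas c ->
    smooth_on (cimg c) (fun u => proj (cinv c u));
  proj_proper : forall K : set R, K `<=` base eps -> compact K ->
    compact (proj @^-1` K);
  proj_rank : forall c : chart R total (1 + (n + n)), atlas c ->
    forall u, cimg c u ->
    \rank (jacobian (fun v => const_mx (proj (cinv c v)) : 'rV[R]_1) u) = 1%N;
  (* the complex manifold M_t, whose underlying smooth manifold is the
     submanifold proj^-1(t) of the total space *)
  fibre : R -> cmanifold R n;
  fibre_compact : forall t, base eps t -> compact [set: fibre t];
  incl : forall t, fibre t -> total;
  incl_smooth : forall t, base eps t -> smooth_map (@incl t);
  incl_inj : forall t, base eps t -> injective (@incl t);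
  incl_range : forall t, base eps t ->
    range (@incl t) = proj @^-1` [set t];
  incl_immersion : forall t, base eps t ->
    forall (c : chart R (fibre t) (n + n)) (d : chart R total (1 + (n + n))),
    atlas c -> atlas d ->
    forall u, (cmap c @` (cdom c `&` @incl t @^-1` cdom d)) u ->
    \rank (jacobian (fun v => cmap d (incl (cinv c v))) u) = (n + n)%N
}.

Arguments incl {R n eps} _ t _.

(** Identification of the fibres with the fixed smooth manifold underlying [M]:
    (t, x) |-> triv t x is a diffeomorphism from I x M to the total space over
    I, whose value at t = 0 identifies the complex manifold M_0 with [M]. *)
Record trivialization (R : realType) (n : nat) (eps : R) (M : cmanifold R n)
    (X : dfamily n eps) := Trivialization {
  triv : forall t, M -> fibre X t;
  triv_inv : forall t, fibre X t -> M;
  trivK : forall t, base eps t -> cancel (triv t) (@triv_inv t);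
  triv_invK : forall t, base eps t -> cancel (@triv_inv t) (triv t);
  triv_smooth : forall t, base eps t -> smooth_map (triv t);
  triv_inv_smooth : forall t, base eps t -> smooth_map (@triv_inv t);
  triv_total_continuous : forall t x, base eps t ->
    {for (t, x), continuous (fun tx : R * M => incl X tx.1 (triv tx.1 tx.2))};
  triv_total_smooth :
    forall (c : chart R M (n + n)) (d : chart R (total X) (1 + (n + n))),
    atlas c -> atlas d ->
    smooth_map_on
      [set v | base_img eps c v /\
         cdom d (incl X (lsubmx v 0 0)
                   (triv (lsubmx v 0 0) (cinv c (rsubmx v))))]
      (fun v => cmap d (incl X (lsubmx v 0 0)
                          (triv (lsubmx v 0 0) (cinv c (rsubmx v)))));
  triv_total_inv : total X -> M;
  triv_total_inv_smooth : smooth_map triv_total_inv;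
  triv_total_invK : forall t x, base eps t ->
    triv_total_inv (incl X t (triv t x)) = x;
  triv0_hol : holomorphic_map (triv 0);
  triv0_inv_hol : holomorphic_map (@triv_inv 0)
}.

Arguments triv {R n eps M X} _ t _.
Arguments triv_inv {R n eps M X} _ t _.

(** A form on M_t regarded as a form on the smooth manifold [M]. *)
Definition on_M (R : realType) (n : nat) (eps : R) (M : cmanifold R n)
    (X : dfamily n eps) (Psi : trivialization M X) (t : R)
    (w : preform (fibre X t)) : preform M :=
  pullback (triv Psi t) (triv_inv Psi t) w.

Definition smooth_family (R : realType) (n : nat) (eps : R)
    (M : cmanifold R n) (w : R -> preform M) : Prop :=
  forall c, smooth_chart c -> forall S,
    smoothC_on (base_img eps c) (fun v => w (lsubmx v 0 0) c (rsubmx v) S).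

(** In local holomorphic coordinates, [phi c u l k] is the coefficient of
    dzbar_k (x) d/dz_l. *)

Definition prevform (R : realType) (n : nat) (X : cmanifold R n) : Type :=
  chart R X (n + n) -> 'rV[R]_(n + n) -> 'M[R[i]]_n.

Definition hol_jacobian (R : realType) (n : nat)
    (tau : 'rV[R]_(n + n) -> 'rV[R]_(n + n)) (u : 'rV[R]_(n + n)) :
  'M[R[i]]_n := \matrix_(k, l) d_z l (fun v => zcoord k (tau v)) u.

Definition is_vform (R : realType) (n : nat) (X : cmanifold R n)
    (phi : prevform X) : Prop :=
  (forall c, hol_chart c -> forall l k,
     smoothC_on (cimg c) (fun u => phi c u l k)) /\
  (forall c d, hol_chart c -> hol_chart d -> forall u, overlap c d u ->
     let J := hol_jacobian (trans c d) u in
     phi d (trans c d u) *m map_mx (@conjc R) J = J *m phi c u).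

Definition smooth_vfamily (R : realType) (n : nat) (eps : R)
    (M : cmanifold R n) (phi : R -> prevform M) : Prop :=
  forall c, hol_chart c -> forall l k,
    smoothC_on (base_img eps c) (fun v => phi (lsubmx v 0 0) c (rsubmx v) l k).

(** The d/dz_k component of the bracket of two T^{1,0}-valued (0,1)-forms,
    [a (x) d/dz_l, b (x) d/dz_k] =
      a ^ (db/dz_l) (x) d/dz_k + b ^ (da/dz_k) (x) d/dz_l. *)
Definition vbracket (R : realType) (n : nat)
    (A B : 'rV[R]_(n + n) -> 'M[R[i]]_n) (k : 'I_n) (u : 'rV[R]_(n + n)) :
  ext R (n + n) :=
  \sum_l (wedge (vcomp (A u) l) (dcoef (d_z l) (fun v => vcomp (B v) k) u) +
          wedge (vcomp (B u) l) (dcoef (d_z l) (fun v => vcomp (A v) k) u)).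

Definition maurer_cartan (R : realType) (n : nat) (X : cmanifold R n)
    (phi : prevform X) : Prop :=
  forall c, hol_chart c -> forall u, cimg c u -> forall k,
    delbar (fun v => vcomp (phi c v) k) u =
    (2^-1 : R[i]) *: vbracket (phi c) (phi c) k u.

Definition phi_holomorphic (R : realType) (n : nat) (X : cmanifold R n)
    (phi : prevform X) (W : set X) (f : X -> R[i]) : Prop :=
  forall c, hol_chart c -> forall u, (cmap c @` (cdom c `&` W)) u ->
    let fc := fun v => f (cinv c v) in
    \sum_k d_zbar k fc u *: dzbar R k
      - \sum_l d_z l fc u *: vcomp (phi c u) l = 0.

Definition parametrized_by (R : realType) (n : nat) (eps : R)
    (M : cmanifold R n) (X : dfamily n eps) (Psi : trivialization M X)
    (phi : R -> prevform M) : Prop :=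
  [/\ forall t, base eps t -> is_vform (phi t),
      smooth_vfamily eps phi,
      forall c, hol_chart c -> forall u, cimg c u -> phi 0 c u = 0,
      forall t, base eps t -> maurer_cartan (phi t) &
      forall t, base eps t -> forall (W : set M) (f : M -> R[i]),
        open W -> smooth_fun W f ->
        (holomorphic_fun (triv Psi t @` W)
           (fun y => f (triv_inv Psi t y)) <->
         phi_holomorphic (phi t) W f)].

Definition deriv0 (R : realType) (f : R -> R[i]) : R[i] :=
  Complex ((fun t => complex.Re (f t))^`() 0)
          ((fun t => complex.Im (f t))^`() 0).

Definition vform_deriv0 (R : realType) (n : nat) (X : cmanifold R n)
    (phi : R -> prevform X) : prevform X :=
  fun c u => \matrix_(l, k) deriv0 (fun t => phi t c u l k).

Definition form_deriv0 (R : realType) (n : nat) (X : cmanifold R n)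
    (w : R -> preform X) : preform X :=
  fun c u => [ffun S => deriv0 (fun t => w t c u S)].

(* Main.v *)
From HB Require Import structures.
Require Import Defs.
From mathcomp Require Import all_boot all_order all_algebra.
From mathcomp Require Import complex.
From mathcomp Require Import all_classical all_reals all_analysis.
From mathcomp Require Import ring lra zify.

(** Read the forms [Omega_t] on the fixed manifold [M], in a holomorphic chart
    of [M].  There they form a smooth family [w t], and each [w t] is closed for
    the exterior derivative [d] of [M], which does not depend on [t]: a chart
    of [M] carried over by the trivialization is a smooth chart of [M_t]
    ([push_chart_smooth], [ext_d_on_M]).  Since [d] commutes with d/dt, the
    derivative [w'(0)] is closed as well ([ext_d_ext_deriv0]); the commutation
    is the symmetry of the second partial derivatives of functions of [t] and
    the coordinates ([partial_comm], [is_derive_partial_slice]).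

    As [phi(0) = 0], the extension map is the identity at [t = 0], and its
    first-order expansion ([has_ext_deriv0_ext_exp]) gives
      [w'(0) = Omega'(0) + iota_(phi'(0)) Omega + beta],
    where [beta] comes from the conjugate contraction.  For the complex
    structure of [M] the three terms have types (p, p), (p-1, p+1) and
    (p+1, p-1).  Hence the component of type (p, p+1) of [d w'(0) = 0] is
      [del (iota_(phi'(0)) Omega) + delbar (Omega'(0)) = 0]
    ([ext_d_component]): no other combination of [del] or [delbar] with one of
    the three terms reaches that type.  The two summands have no other
    components, so this is the claimed equality.

    The calculus behind these steps is built on [smooth_on], which speaks of
    iterated partial derivatives only: functions with continuous partial
    derivatives are differentiable ([differentiable_C1]), which gives the chain
    rule and the smoothness of composites ([Ck_comp]), needed because smooth
    maps of manifolds are tested in charts of the atlases only. *)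

Set Implicit Arguments.
Unset Strict Implicit.
Unset Printing Implicit Defensive.

Import Order.TTheory GRing.Theory Num.Theory.
Import numFieldNormedType.Exports.

Local Open Scope ring_scope.

(** * Exterior algebra and types of forms *)

Section ExteriorAlgebra.
Import mathcomp.boot.finset.
Context {R : realType} {m : nat}.
Implicit Types (a b c : ext R m) (A B C S T : {set 'I_m}).

Lemma ext_decomp a : a = \sum_S a S *: ebasis S.
Proof.
apply/ffunP => T; rewrite sum_ffunE (bigD1 T)//= big1 ?addr0 => [|S ST].
  by rewrite !ffunE eqxx [_ *: _]mulr1.
by rewrite !ffunE eq_sym (negbTE ST) [_ *: _]mulr0.
Qed.

Lemma wedgeDl a b c : wedge (a + b) c = wedge a c + wedge b c.
Proof.
apply/ffunP => S; rewrite !ffunE -big_split; apply: eq_bigr => A _ /=.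
by rewrite !ffunE mulrDr mulrDl.
Qed.

Lemma wedgeDr a b c : wedge a (b + c) = wedge a b + wedge a c.
Proof.
apply/ffunP => S; rewrite !ffunE -big_split; apply: eq_bigr => A _ /=.
by rewrite !ffunE mulrDr.
Qed.

Lemma wedgeZl (k : R[i]) a b : wedge (k *: a) b = k *: wedge a b.
Proof.
apply/ffunP => S; rewrite !ffunE [RHS]mulr_sumr; apply: eq_bigr => A _ /=.
by rewrite !ffunE -[_ *: _]/(k * _); ring.
Qed.

Lemma wedgeZr (k : R[i]) a b : wedge a (k *: b) = k *: wedge a b.
Proof.
apply/ffunP => S; rewrite !ffunE [RHS]mulr_sumr; apply: eq_bigr => A _ /=.
by rewrite !ffunE -[_ *: _]/(k * _); ring.
Qed.

Lemma wedge0r a : wedge 0 a = 0.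
Proof. by rewrite -(scale0r 0) wedgeZl !scale0r. Qed.

Lemma wedger0 a : wedge a 0 = 0.
Proof. by rewrite -[X in wedge a X](scale0r 0) wedgeZr !scale0r. Qed.

Lemma wedge_suml (I : Type) (r : seq I) (P : pred I) (f : I -> ext R m) b :
  wedge (\sum_(i <- r | P i) f i) b = \sum_(i <- r | P i) wedge (f i) b.
Proof. by apply: (big_morph (wedge^~ b)); [move=> ? ?; exact: wedgeDl|exact: wedge0r]. Qed.

Lemma interior_prodD s a b :
  interior_prod s (a + b) = interior_prod s a + interior_prod s b.
Proof.
by apply/ffunP => S; rewrite !ffunE; case: ifP; rewrite ?addr0// mulrDr.
Qed.

Lemma interior_prodZ s (k : R[i]) a :
  interior_prod s (k *: a) = k *: interior_prod s a.
Proof.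
apply/ffunP => S; rewrite !ffunE; case: ifP => _; first by rewrite [_ *: _]mulr0.
exact: mulrCA.
Qed.

Lemma wedge_ebasis A B : wedge (ebasis A) (ebasis B) =
  (if [disjoint A & B] then shuffle_sign R A B else 0) *: ebasis (A :|: B)
  :> ext R m.
Proof.
apply/ffunP => S; rewrite ffunE.
have -> : \sum_(C : {set 'I_m} | C \subset S) shuffle_sign R C (S :\: C) *
      (ebasis A : ext R m) C * (ebasis B : ext R m) (S :\: C) =
    if (A \subset S) && (S :\: A == B) then shuffle_sign R A B else 0.
  case: (boolP (A \subset S)) => AS /=.
    rewrite (bigD1 A)//= big1 ?addr0 => [|C /andP[_ CA]].
      by rewrite !ffunE eqxx mulr1; case: eqP => [->|]; rewrite ?mulr1 ?mulr0.
    by rewrite !ffunE (negbTE CA) mulr0 mul0r.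
  rewrite big1// => C CS; rewrite !ffunE; case: eqP => [CA|_].
    by rewrite -CA CS in AS.
  by rewrite mulr0 mul0r.
case: (boolP [disjoint A & B]) => dAB.
  rewrite !ffunE; case: ifP.
    move=> /andP[AS /eqP <-].
    have -> : A :|: S :\: A = S by rewrite -[RHS](setID S A) (setIidPr AS).
    by rewrite eqxx [_ *: _]mulr1.
  move=> /negbT H; case: eqP => [E|_]; last by rewrite [_ *: _]mulr0.
  case/negP: H; rewrite E subsetUl /= setDUl setDv set0U.
  by apply/eqP/setDidPl; rewrite disjoint_sym.
rewrite scale0r ffunE; case: ifP => // /andP[AS /eqP BE].
by case/negP: dAB; rewrite -BE -setI_eq0 setIDA setDIl setDv set0I.
Qed.

Lemma shuffle_signUl A B C : [disjoint A & B] ->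
  shuffle_sign R (A :|: B) C = shuffle_sign R A C * shuffle_sign R B C.
Proof.
move=> dAB; rewrite /shuffle_sign -exprD; congr (_ ^+ _).
rewrite -cardsUI [X in (_ + #|pred_of_set X|)%N](_ : _ = finset.set0).
  rewrite cards0 addn0; apply: eq_card => -[i j]; rewrite !inE /=.
  by rewrite andb_orl.
apply/setP => -[i j]; rewrite !inE /=; apply/negP => /andP[/and3P[iA _ _] /and3P[iB _ _]].
by move: dAB => /pred0P/(_ i)/=; rewrite iA iB.
Qed.

Lemma shuffle_signUr A B C : [disjoint B & C] ->
  shuffle_sign R A (B :|: C) = shuffle_sign R A B * shuffle_sign R A C.
Proof.
move=> dBC; rewrite /shuffle_sign -exprD; congr (_ ^+ _).
rewrite -cardsUI [X in (_ + #|pred_of_set X|)%N](_ : _ = finset.set0).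
  rewrite cards0 addn0; apply: eq_card => -[i j]; rewrite !inE /=.
  by rewrite -andb_orr -andb_orl.
apply/setP => -[i j]; rewrite !inE /=; apply/negP => /andP[/and3P[_ iB _] /and3P[_ iC _]].
by move: dBC => /pred0P/(_ j)/=; rewrite iB iC.
Qed.

(** Both sides vanish unless the three sets are pairwise disjoint, and then the
    signs agree because [shuffle_sign] is multiplicative in each argument. *)
Lemma wedge_ebasisA A B C :
  wedge (wedge (ebasis A) (ebasis B)) (ebasis C) =
  wedge (ebasis A) (wedge (ebasis B) (ebasis C)) :> ext R m.
Proof.
rewrite (wedge_ebasis A B) (wedge_ebasis B C) wedgeZl wedgeZr.
rewrite (wedge_ebasis (A :|: B)) (wedge_ebasis A (B :|: C)) !scalerA setUA.
congr (_ *: _).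
have -> : [disjoint A :|: B & C] = [disjoint A & C] && [disjoint B & C].
  by rewrite !disjoints_subset subUset.
have -> : [disjoint A & B :|: C] = [disjoint A & B] && [disjoint A & C].
  by rewrite !disjoints_subset setCU subsetI.
case: (boolP [disjoint A & B]) => dAB; case: (boolP [disjoint B & C]) => dBC;
  rewrite ?andbT ?andbF /= ?(mulr0, mul0r)//.
case: ifP => _; last by rewrite !mulr0.
by rewrite shuffle_signUl// shuffle_signUr//; ring.
Qed.

(** The condition on [s] is put in the coefficient, so that products of such
    expressions can be rewritten without a case distinction. *)
Lemma interior_ebasis s S : interior_prod s (ebasis S) =
  (if s \in S then (-1) ^+ #|[set j in S | (j < s)%N]|%SET else 0)
    *: ebasis (S :\ s) :> ext R m.
Proof.
apply/ffunP => T; rewrite !ffunE.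
case: (boolP (s \in T)) => sT.
  case: eqP => [E|_]; last by rewrite [_ *: _]mulr0.
  by rewrite E !inE eqxx in sT.
case: (boolP (s \in S)) => sS; last first.
  rewrite [RHS]mul0r; case: eqP => [E|_]; last by rewrite mulr0.
  by rewrite -E !inE eqxx in sS.
case: eqP => [E|nE].
  rewrite -E setU1K// eqxx; congr ((-1) ^+ _ * _).
  apply: eq_card => j; rewrite !inE; case: eqVneq => //= ->.
  by rewrite ltnn !andbF.
case: eqP => [E|_]; last by rewrite [_ *: _]mulr0 mulr0.
by case: nE; rewrite E setD1K.
Qed.

(** Locality of the product by a generator: this is what lets one component of
    a derivative be computed from few components of the form. *)
Lemma wedge_ebasis1_coef s a b T :
  (s \in T -> a (T :\ s) = b (T :\ s)) ->
  wedge (ebasis [set s]%SET) a T = wedge (ebasis [set s]%SET) b T.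
Proof.
move=> ab; rewrite !ffunE; apply: eq_bigr => A AT; rewrite !ffunE.
case: eqP => [E|_]; last by rewrite mulr0 !mul0r.
by rewrite E ab// (fintype.subsetP AT)// E inE.
Qed.

End ExteriorAlgebra.

Section TypeDecomposition.
Import mathcomp.boot.finset.
Context {R : realType} {n : nat}.
Implicit Types (a b : ext R (n + n)) (S T P Q : {set 'I_(n + n)}) (j : 'I_n).

Local Notation D := (dz_indices n).

Lemma lshift_dz j : lshift n j \in D.
Proof. exact: imset_f. Qed.

Lemma rshift_dz j : rshift n j \notin D.
Proof. by apply/imsetP => -[i _ /eqP]; rewrite eq_rlshift. Qed.

Lemma has_type_coef0 p q a S : has_type p q a ->
  (#|S :&: D|, #|S :\: D|) != (p, q) -> a S = 0.
Proof.
by move=> ta; apply: contraNeq => /ta[-> ->].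
Qed.

Lemma has_type0 p q : has_type p q (0 : ext R (n + n)).
Proof. by move=> S; rewrite ffunE eqxx. Qed.

Lemma has_typeD p q a b : has_type p q a -> has_type p q b ->
  has_type p q (a + b).
Proof.
move=> ta tb S; rewrite ffunE; have [a0|/ta//] := eqVneq (a S) 0.
by rewrite a0 add0r => /tb.
Qed.

Lemma has_typeZ p q (k : R[i]) a : (k != 0 -> has_type p q a) ->
  has_type p q (k *: a).
Proof.
by move=> ta S; rewrite ffunE; rewrite mulf_eq0 negb_or => /andP[/ta +]; apply.
Qed.

Lemma has_type_sum p q (I : Type) (r : seq I) (f : I -> ext R (n + n)) :
  (forall i, has_type p q (f i)) -> has_type p q (\sum_(i <- r) f i).
Proof.
by move=> tf; apply: big_ind => //; [exact: has_type0|exact: has_typeD].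
Qed.

Lemma has_type_ebasis S : has_type #|S :&: D| #|S :\: D| (ebasis S : ext R _).
Proof. by move=> T; rewrite ffunE; case: (eqVneq T S) => [->|]; rewrite ?eqxx. Qed.

Lemma has_type_dz j : has_type 1 0 (dz R j).
Proof.
have := @has_type_ebasis [set lshift n j].
rewrite (setIidPl _) ?sub1set ?lshift_dz// cards1.
by rewrite (_ : _ :\: _ = set0) ?cards0//; apply/eqP; rewrite setD_eq0 sub1set lshift_dz.
Qed.

Lemma has_type_dzbar j : has_type 0 1 (dzbar R j).
Proof.
have := @has_type_ebasis [set rshift n j].
rewrite (setDidPl _) ?disjoints1 ?rshift_dz// cards1 disjoint_setI0 ?cards0//.
by rewrite disjoints1 rshift_dz.
Qed.

(** A nonzero coefficient of the product at [S] comes from a splitting of [S]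
    into two pieces whose types are known. *)
Lemma has_type_wedge p q p' q' a b : has_type p q a -> has_type p' q' b ->
  has_type (p + p') (q + q') (wedge a b).
Proof.
move=> ta tb S; rewrite ffunE => S0.
have [A AS] : exists2 A : {set _}, A \subset S & a A * b (S :\: A) != 0.
  have [/exists_inP[A AS A0]|/exists_inPn H] :=
      boolP [exists (A : {set _} | A \subset S), a A * b (S :\: A) != 0].
    by exists A.
  case/eqP: S0; rewrite big1// => A /H; rewrite negbK -mulrA => /eqP ->.
  by rewrite mulr0.
rewrite mulf_eq0 negb_or => /andP[/ta[<- <-] /tb[<- <-]].
rewrite -(cardsID A (S :&: D)) -(cardsID A (S :\: D)).
have E : S :&: A = A by apply/setIidPr.
rewrite setIAC E [(S :\: D) :&: A]setIDAC E [(S :\: A) :&: D]setIDAC.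
by rewrite setDDl setUC -setDDl.
Qed.

Lemma card_type_setD1 p q s T : (#|T :&: D|, #|T :\: D|) = (p, q) ->
  s \in T -> (#|(T :\ s) :&: D|, #|(T :\ s) :\: D|) =
             if s \in D then (p.-1, q) else (p, q.-1).
Proof.
move=> [<- <-] sT; rewrite setIDAC setDDl setUC -setDDl.
case: ifP => sD; congr (_, _).
- by rewrite [in RHS](cardsD1 s) inE sT sD.
- by rewrite (setDidPl _)// disjoint_sym disjoints1 !inE sD.
- by rewrite (setDidPl _)// disjoint_sym disjoints1 !inE sD andbF.
- by rewrite [in RHS](cardsD1 s) inE sT sD.
Qed.

Lemma has_type_interior_dz p q j a : has_type p.+1 q a ->
  has_type p q (interior_prod (lshift n j) a).
Proof.
move=> ta S; rewrite ffunE; case: ifP => [|/negbT jS]; first by rewrite eqxx.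
rewrite mulf_eq0 negb_or => /andP[_ /ta[cp cq]].
have := card_type_setD1 (congr2 pair cp cq) (setU11 _ _).
by rewrite lshift_dz setU1K// => -[].
Qed.

Lemma has_type_interior_dzbar p q j a : has_type p q.+1 a ->
  has_type p q (interior_prod (rshift n j) a).
Proof.
move=> ta S; rewrite ffunE; case: ifP => [|/negbT jS]; first by rewrite eqxx.
rewrite mulf_eq0 negb_or => /andP[_ /ta[cp cq]].
have := card_type_setD1 (congr2 pair cp cq) (setU11 _ _).
by rewrite (negbTE (rshift_dz j)) setU1K// => -[].
Qed.

Lemma has_type_iota_v p q (A : 'M[R[i]]_n) a : has_type p.+1 q a ->
  has_type p q.+1 (iota_v A a).
Proof.
move=> ta; apply: has_type_sum => l; rewrite -(add0n p) -(add1n q).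
apply: has_type_wedge; last exact: has_type_interior_dz.
by apply: has_type_sum => k; apply: has_typeZ => _; exact: has_type_dzbar.
Qed.

Lemma has_type_iota_vbar p q (A : 'M[R[i]]_n) a : has_type p q.+1 a ->
  has_type p.+1 q (iota_vbar A a).
Proof.
move=> ta; apply: has_type_sum => l; rewrite -(add0n q) -(add1n p).
apply: has_type_wedge; last exact: has_type_interior_dzbar.
by apply: has_type_sum => k; apply: has_typeZ => _; exact: has_type_dz.
Qed.

Lemma iota_vD (A : 'M[R[i]]_n) a b : iota_v A (a + b) = iota_v A a + iota_v A b.
Proof.
rewrite /iota_v -big_split; apply: eq_bigr => l _.
by rewrite interior_prodD wedgeDr.
Qed.

Lemma iota_vZ (A : 'M[R[i]]_n) (k : R[i]) a : iota_v A (k *: a) = k *: iota_v A a.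
Proof.
rewrite /iota_v scaler_sumr; apply: eq_bigr => l _.
by rewrite interior_prodZ wedgeZr.
Qed.

Lemma iota_v_sum (A : 'M[R[i]]_n) (I : Type) (r : seq I) (f : I -> ext R (n + n)) :
  iota_v A (\sum_(i <- r) f i) = \sum_(i <- r) iota_v A (f i).
Proof.
apply: (big_morph (iota_v A)); first exact: iota_vD.
by rewrite -(scale0r 0) iota_vZ !scale0r.
Qed.

Lemma iota_v0l a : iota_v 0 a = 0.
Proof.
rewrite /iota_v big1// => l _; rewrite /vcomp big1 ?wedge0r// => k _.
by rewrite mxE scale0r.
Qed.

Lemma iota_vbar0l a : iota_vbar 0 a = 0.
Proof.
rewrite /iota_vbar big1// => l _; rewrite big1 ?wedge0r// => k _.
by rewrite mxE conjc0 scale0r.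
Qed.

(** All dz's precede all dzbar's in the chosen order of the generators. *)
Lemma shuffle_sign_dz P Q : P \subset D -> [disjoint Q & D] ->
  shuffle_sign R P Q = 1.
Proof.
move=> PD QD; rewrite /shuffle_sign (_ : [set _ | _] = set0) ?cards0//.
apply/setP => -[i k]; rewrite !inE /=; apply/negP => /and3P[iP kQ].
have /imsetP[i' _ ->] := fintype.subsetP PD _ iP.
have /negP kD := disjointFr QD kQ.
case: (split_ordP k) => k' kE; first by rewrite kE lshift_dz in kD.
by rewrite kE ltnNge /= ltnW// ltn_addr.
Qed.

Lemma disjoint_dz P Q : P \subset D -> [disjoint Q & D] -> [disjoint P & Q].
Proof. by move=> PD; rewrite disjoint_sym => /(disjointWl PD). Qed.

Lemma wedge_ebasis_dz P Q : P \subset D -> [disjoint Q & D] ->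
  wedge (ebasis P) (ebasis Q) = ebasis (P :|: Q) :> ext R (n + n).
Proof.
move=> PD QD.
by rewrite wedge_ebasis disjoint_dz// shuffle_sign_dz// scale1r.
Qed.

(** The interior product by d/dz_j is an antiderivation and kills the dzbar's,
    so it only acts on the first factor. *)
Lemma interior_wedge_dz j P Q : P \subset D -> [disjoint Q & D] ->
  wedge (interior_prod (lshift n j) (ebasis P)) (ebasis Q) =
  interior_prod (lshift n j) (ebasis (P :|: Q)) :> ext R (n + n).
Proof.
move=> PD QD; rewrite !interior_ebasis !inE.
have jQ : (lshift n j \in Q) = false by apply: disjointFl QD (lshift_dz j).
have PjD : P :\ lshift n j \subset D by exact: fintype.subset_trans (subD1set _ _) PD.
rewrite jQ orbF wedgeZl (wedge_ebasis_dz PjD QD).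
congr ((if _ then _ ^+ _ else _) *: ebasis _).
  apply: eq_card => k; rewrite !inE; case: (boolP (k \in Q)) => kQ; rewrite ?orbF// orbT.
  case: (split_ordP k) kQ => k' ->.
    by move=> kQ; have := disjointFl QD (lshift_dz k'); rewrite kQ.
  by move=> _ /=; rewrite [(_ < _)%N]ltnNge (ltnW (ltn_addr _ _))// andbF.
apply/setP => k; rewrite !inE; case: eqVneq => //= ->.
by rewrite jQ.
Qed.

(** This is why contracting the dz's of a monomial separately, as the
    extension map does, amounts to contracting the whole monomial. *)
Lemma iota_v_wedge_dz (A : 'M[R[i]]_n) P Q : P \subset D -> [disjoint Q & D] ->
  wedge (iota_v A (ebasis P)) (ebasis Q) = iota_v A (ebasis (P :|: Q)).
Proof.
move=> PD QD; rewrite /iota_v wedge_suml; apply: eq_bigr => l _.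
rewrite /vcomp !wedge_suml; apply: eq_bigr => k _.
rewrite -interior_wedge_dz// !wedgeZl; congr (_ *: _).
by rewrite interior_ebasis wedgeZr !wedgeZl wedgeZr wedge_ebasisA.
Qed.

Lemma dz_split_sub S : S :&: D \subset D.
Proof. exact: subsetIr. Qed.

Lemma dz_split_disjoint S : [disjoint S :\: D & D].
Proof. by rewrite -setI_eq0 setIDAC setDIl setDv setI0. Qed.

End TypeDecomposition.

Local Open Scope classical_set_scope.
Local Open Scope ring_scope.

(** * Differentiable functions of several real variables *)

Lemma is_derive_line (R : realType) (V : normedModType R) (f : V -> R)
    (x v : V) (s : R) : derivable f (x + s *: v) v ->
  is_derive s 1 (fun r : R => f (x + r *: v)) ('D_v f (x + s *: v)).
Proof.
have E : (fun h : R => h^-1 *: (((fun r : R => f (x + r *: v)) \o shift s)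
             (h *: (1 : R)) - f (x + s *: v))) =
         (fun h : R => h^-1 *: ((f \o shift (x + s *: v)) (h *: v)
             - f (x + s *: v))).
  apply/funext => h /=; congr (_ *: (f _ - _)).
  by rewrite [h%:A]mulr1 scalerDl addrCA addrA.
move=> df; split; first by rewrite /derivable E.
by rewrite /derive E.
Qed.

(** Taking a signed length [a] avoids a distinction on the sense in which the
    segment is run through. *)
Lemma MVT_line (R : realType) (V : normedModType R) (f : V -> R)
    (x v : V) (a : R) :
  (forall s, `|s| <= `|a| -> derivable f (x + s *: v) v) ->
  exists2 s, `|s| <= `|a| & f (x + a *: v) - f x = a * 'D_v f (x + s *: v).
Proof.
move=> df.
pose g r := f (x + (r * a) *: v).
have dg (r : R) : `|r| <= 1 -> is_derive r 1 g (a * 'D_v f (x + (r * a) *: v)).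
  move=> r1; have ra : `|r * a| <= `|a| by rewrite normrM ler_piMl.
  have d1 := is_derive_line (df _ ra).
  have d2 : is_derive r 1 (fun r : R => r * a) a.
    have := @is_deriveM _ _ (@id R) (cst a) r 1 _ _ (is_derive_id _ _) (is_derive_cst _ _ _).
    by rewrite /= scaler0 add0r [a *: _]mulr1.
  have [d11 d12] := d1; have [d21 d22] := d2.
  have -> : g = (fun s : R => f (x + s *: v)) \o (fun r : R => r * a) by [].
  split.
    apply/derivable1_diffP; apply: differentiable_comp.
      exact: (derivable1_diffP _ _).1 d21.
    exact: (derivable1_diffP _ _).1 d11.
  by rewrite -derive1E derive1_comp// !derive1E d12 d22 mulrC.
have [|r||s] := @MVT_segment R g (fun r => a * 'D_v f (x + (r * a) *: v)) 0 1.
- exact: ler01.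
- by rewrite in_itv /= => /andP[r0 r1]; apply: dg; rewrite ger0_norm ltW.
- apply: derivable_within_continuous => r; rewrite in_itv /= => /andP[r0 r1].
  by have [] := dg r; rewrite ?ger0_norm.
- rewrite in_itv /= => /andP[s0 s1]; rewrite /g !mul1r mul0r scale0r addr0 subr0 mulr1.
  by move=> ->; exists (s * a) => //; rewrite normrM ler_piMl// ger0_norm.
Qed.

Lemma norm_row_le (R : realType) m (z : 'rV[R]_m) (e : R) : 0 <= e ->
  (forall j, `|z 0 j| <= e) -> `|z| <= e.
Proof.
move=> e0 ze; rewrite [leLHS]/Num.Def.normr/= mx_normrE.
by apply: bigmax_le => // -[i j] _ /=; rewrite ord1.
Qed.

Lemma norm_coord_le (R : realType) m (z : 'rV[R]_m) j : `|z 0 j| <= `|z|.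
Proof.
rewrite [leRHS]/Num.Def.normr/= mx_normrE.
exact: (le_bigmax _ (fun ij : 'I_1 * 'I_m => `|z ij.1 ij.2|) (0, j)).
Qed.

(** Go from [x] to [z] by changing one coordinate at a time.  By the mean value
    theorem each step is the increment of that coordinate times a partial
    derivative at a point as close to [x] as [z] is. *)
Lemma C1_increment (R : realType) m (f : 'rV[R]_m -> R) (x : 'rV[R]_m) (e : R) :
  (forall j, \forall z \near x, derivable f z (delta_mx 0 j)) ->
  (forall j, {for x, continuous (partial j f)}) -> 0 < e ->
  \forall z \near x,
    `|f z - f x - \sum_j (z - x) 0 j * partial j f x| <= e * `|z - x|.
Proof.
move=> df cf e0.
(* the relative error allowed in each of the [m] steps; [m.+1] is never 0 *)
pose e' := e / m.+1%:R.
have e'0 : 0 < e' by rewrite divr_gt0.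
have : \forall z \near x, forall j, derivable f z (delta_mx 0 j) /\
    `|partial j f z - partial j f x| <= e'.
  refine (@filter_forall _ _ (fun (j : 'I_m) z => derivable f z (delta_mx 0 j) /\
    `|partial j f z - partial j f x| <= e') (nbhs x) _ _) => j.
  near=> z; split; first by near: z; exact: df.
  rewrite distrC; near: z.
  by have /cvgrPdist_le := cf j; apply.
move=> /nbhs_ballP[d /= d0 H].
apply/nbhs_ballP; exists d => // z xz.
rewrite -ball_normE /= distrC in xz.
(* the point reached after [k] steps *)
pose y k : 'rV[R]_m := \row_j (if (j < k)%N then z 0 j else x 0 j).
have y0 : y 0%N = x by apply/rowP => j; rewrite mxE.
have ym : y m = z by apply/rowP => j; rewrite mxE ltn_ord.
have yS (j : 'I_m) : y j.+1 = y j + (z - x) 0 j *: delta_mx 0 j.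
  apply/rowP => k; rewrite !mxE eqxx /= ltnS leq_eqVlt.
  case: (eqVneq k j) => [->|kj]; first by rewrite eqxx ltnn /= mulr1 addrC subrK.
  have -> : (k == j :> nat) = false by apply/negbTE.
  by rewrite /= mulr0 addr0.
have tel : f z - f x = \sum_(j < m) (f (y j.+1) - f (y j)).
  by rewrite -(big_mkord xpredT (fun j => f (y j.+1) - f (y j))) telescope_sumr// y0 ym.
have yb (j : 'I_m) s : `|s| <= `|(z - x) 0 j| -> ball x d (y j + s *: delta_mx 0 j).
  move=> sz; rewrite -ball_normE /= distrC; apply: le_lt_trans xz.
  apply: norm_row_le => // k; rewrite !mxE eqxx /=.
  case: (eqVneq k j) => [->|kj].
    rewrite ltnn mulr1 addrAC subrr add0r.
    exact: le_trans sz (norm_coord_le _ _).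
  rewrite mulr0 addr0; case: ifP => _; last by rewrite subrr normr0.
  by have := norm_coord_le (z - x) k; rewrite !mxE.
rewrite tel -sumrB; apply: (le_trans (ler_norm_sum _ _ _)).
apply: (@le_trans _ _ (\sum_(j < m) (e' * `|z - x|))); last first.
  rewrite sumr_const card_ord -[leLHS]mulr_natr mulrAC ler_wpM2r//.
  by rewrite -mulrA ler_piMr ?(ltW e0)// mulrC ler_pdivrMr// mul1r ler_nat.
apply: ler_sum => j _; rewrite yS.
have [s sz ->] := @MVT_line R _ f (y j) (delta_mx 0 j) ((z - x) 0 j)
   (fun s sz => (H _ (yb j s sz) j).1).
rewrite -mulrBr normrM mulrC ler_pM ?norm_coord_le//.
exact: (H _ (yb j s sz) j).2.
Unshelve. all: by end_near. Qed.

Lemma continuous_sumr (R : realType) (T : topologicalType) (I : Type)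
    (r : seq I) (f : I -> T -> R) (x : T) :
  (forall i, {for x, continuous (f i)}) ->
  {for x, continuous (fun z => \sum_(i <- r) f i z)}.
Proof.
move=> cf; elim: r => [|i r IH].
  have -> : (fun z => \sum_(i <- [::]) f i z) = cst 0.
    by apply/funext => z; rewrite big_nil.
  exact: cvg_cst.
have -> : (fun z => \sum_(i <- i :: r) f i z) =
          (fun z => f i z + \sum_(i <- r) f i z).
  by apply/funext => z; rewrite big_cons.
by apply: cvgD; [exact: cf|exact: IH].
Qed.

Section GradientForm.
Context {R : realType} {m : nat} (a : 'I_m -> R).

(** The differential of a function with partial derivatives [a]; it is bundled
    as a linear map, as the theory of differentials requires. *)
Definition gradient_form (h : 'rV[R]_m) : R := \sum_j h 0 j * a j.

Lemma gradient_form_linear : linear gradient_form.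
Proof.
move=> k x y; rewrite /gradient_form scaler_sumr -big_split /=.
by apply: eq_bigr => j _; rewrite !mxE mulrDl -mulrA.
Qed.

HB.instance Definition _ :=
  GRing.isLinear.Build R 'rV[R]_m R _ gradient_form gradient_form_linear.

Lemma gradient_form_continuous : continuous gradient_form.
Proof.
move=> x; apply: continuous_sumr => j.
have c1 : {for x, continuous (fun z : 'rV[R]_m => z 0 j)}.
  exact: (@coord_continuous _ _ _ 0 j x).
have c2 : {for x, continuous (cst (a j) : 'rV[R]_m -> R)}.
  exact: cst_continuous.
exact: (continuousM c1 c2).
Qed.
End GradientForm.

Lemma differentiable_C1 (R : realType) m (f : 'rV[R]_m -> R) (x : 'rV[R]_m) :
  (forall j, \forall z \near x, derivable f z (delta_mx 0 j)) ->
  (forall j, {for x, continuous (partial j f)}) ->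
  differentiable f x.
Proof.
move=> df cf.
pose a j := partial j f x.
have L (e : R) : 0 < e -> \forall z \near (0 : 'rV[R]_m),
    `|f (z + x) - (f x + gradient_form a z)| <= e * `|z|.
  move=> e0; have := C1_increment df cf e0; rewrite (near_shift 0) => H.
  near=> z.
  have /= : (fun z => `|f z - f x - \sum_j (z - x) 0 j * partial j f x|
       <= e * `|z - x|) (shift (x - 0) z) by near: z.
  by rewrite subr0 addrK opprD addrA.
have D : 'd (f : 'rV[R]_m -> R^o) x = gradient_form a :> ('rV[R]_m -> R^o).
  apply: diff_unique; first exact: gradient_form_continuous.
  by apply/eqaddoP => e e0; exact: L.
apply/diff_locallyP; split; first by rewrite D; exact: gradient_form_continuous.
by rewrite D; apply/eqaddoP => e e0; exact: L.
Unshelve. all: by end_near. Qed.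

(** The chain rule needs [f] to be differentiable, but [g] only to have
    derivatives along [delta_mx 0 i]: it is enough to follow the image of the
    line through [u] in that direction. *)
Lemma is_derive_curve (R : realType) m k (g : 'rV[R]_m -> 'rV[R]_k)
    (f : 'rV[R]_k -> R) (u : 'rV[R]_m) (i : 'I_m) :
  (forall j, derivable (fun v => g v 0 j) u (delta_mx 0 i)) ->
  (forall j, \forall z \near g u, derivable f z (delta_mx 0 j)) ->
  (forall j, {for g u, continuous (partial j f)}) ->
  is_derive u (delta_mx 0 i) (f \o g)
    (\sum_j partial j f (g u) * partial i (fun v => g v 0 j) u).
Proof.
move=> dg df cf.
have Df := differentiable_C1 df cf.
pose c := fun h : R => g (h *: delta_mx 0 i + u).
have c0 : c 0 = g u by rewrite /c scale0r add0r.
have dc : derivable c 0 1.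
  apply/derivable_mxP => l j; rewrite (ord1 l).
  by have := dg j => /derivable1P.
have dc' : 'D_1 c 0 = 'D_(delta_mx 0 i) g u.
  by rewrite /derive /c; under eq_fun do rewrite /= addr0 scale0r add0r [_%:A]mulr1.
have dgu : derivable g u (delta_mx 0 i).
  by apply/derivable_mxP => l j; rewrite (ord1 l).
have Dc : differentiable c 0 := (derivable1_diffP c 0).1 dc.
have Dfc : differentiable (f \o c) 0.
  by apply: differentiable_comp Dc _; rewrite c0.
split.
  by apply/derivable1P; apply/derivable1_diffP.
have -> : 'D_(delta_mx 0 i) (f \o g) u = 'D_1 (f \o c) 0.
  by rewrite /derive /c; under [in RHS]eq_fun do
    rewrite /= addr0 scale0r add0r [_%:A]mulr1.
rewrite deriveE// diff_comp//; last by rewrite c0.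
rewrite /= -(deriveE _ Dc) dc' c0 derive_mx//.
set w := \matrix_(_, _) _.
rewrite [w]matrix_sum_delta big_ord1 linear_sum /=; apply: eq_bigr => j _.
by rewrite linearZ /= -deriveE// /w mxE mulrC.
Qed.

Lemma derive_translate (R : realType) (V : normedModType R) (f : V -> R)
    (c z v : V) : derivable f (z + c) v ->
  is_derive z v (fun y => f (y + c)) ('D_v f (z + c)).
Proof.
have E : (fun h : R => h^-1 *: (((fun y => f (y + c)) \o shift z) (h *: v)
                                 - f (z + c))) =
         (fun h : R => h^-1 *: ((f \o shift (z + c)) (h *: v) - f (z + c))).
  by apply/funext => h /=; rewrite addrA.
by move=> df; split; rewrite ?/derivable ?/derive E.
Qed.

(** Applying the mean value theorem in the direction [v] and then in the
    direction [w] turns a second difference of [f] into a second derivative;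
    the left-hand side is symmetric in [v] and [w]. *)
Lemma MVT_second_difference (R : realType) (V : normedModType R) (f : V -> R)
    (x v w : V) (h : R) :
  (forall s r, `|s| <= `|h| -> `|r| <= `|h| ->
     derivable f (x + s *: v + r *: w) v /\
     derivable (fun z => 'D_v f z) (x + s *: v + r *: w) w) ->
  exists s r, [/\ `|s| <= `|h|, `|r| <= `|h| &
    f (x + h *: v + h *: w) - f (x + h *: v) - f (x + h *: w) + f x =
    h * (h * 'D_w (fun z => 'D_v f z) (x + s *: v + r *: w))].
Proof.
move=> df.
pose g z := f (z + h *: w) - f z.
have dg s : `|s| <= `|h| -> is_derive (x + s *: v) v g
   ('D_v f (x + s *: v + h *: w) - 'D_v f (x + s *: v)).
  move=> sh; have h0 : `|0 : R| <= `|h| by rewrite normr0.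
  have [d1 _] := df s h sh (lexx _).
  have [d2 _] := df s 0 sh h0.
  rewrite scale0r addr0 in d2.
  have D1 := derive_translate d1.
  have D2 : is_derive (x + s *: v) v f ('D_v f (x + s *: v)) by split.
  exact: is_deriveB.
have [s sh E1] := @MVT_line R V g x v h (fun s sh => @ex_derive _ _ _ _ _ _ _ (dg s sh)).
have [r rh E2] := @MVT_line R V (fun z => 'D_v f z) (x + s *: v) w h
   (fun r rh => (df s r sh rh).2).
exists s, r; split => //.
have [_ dgs] := dg s sh.
by rewrite -E2 -dgs -E1 /g opprB !addrA addrAC.
Qed.

Lemma dist_le_half (R : realFieldType) (a b c e : R) :
  `|a - c| <= e / 2 -> `|b - c| <= e / 2 -> `|a - b| <= e.
Proof.
move=> ac bc; rewrite (le_trans (ler_distD c _ _))// (splitr e) lerD//.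
by rewrite distrC.
Qed.

(** Both mixed derivatives, at points close to [u], equal the same second
    difference of [f] divided by the square of the step; let the step tend
    to 0. *)
Lemma partial_comm (R : realType) (m : nat) (U : set 'rV[R]_m)
    (f : 'rV[R]_m -> R) (i j : 'I_m) (u : 'rV[R]_m) :
  open U -> smooth_on U f -> U u ->
  partial i (partial j f) u = partial j (partial i f) u.
Proof.
move=> oU sf Uu.
apply/eqP; rewrite -subr_eq0 -normr_le0; apply/ler_addgt0Pl => e e0.
rewrite addr0.
have e2 : 0 < e / 2 by rewrite divr_gt0.
have cij : {for u, continuous (partial i (partial j f))}.
  by have [] := sf [:: i; j] u Uu.
have cji : {for u, continuous (partial j (partial i f))}.
  by have [] := sf [:: j; i] u Uu.
have [d /= d0 H] : exists2 d : R, 0 < d & forall z, ball u d z ->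
    [/\ U z, `|partial i (partial j f) u - partial i (partial j f) z| <= e / 2 &
        `|partial j (partial i f) u - partial j (partial i f) z| <= e / 2].
  have : \forall z \near u, [/\ U z,
        `|partial i (partial j f) u - partial i (partial j f) z| <= e / 2 &
        `|partial j (partial i f) u - partial j (partial i f) z| <= e / 2].
    move/cvgrPdist_le : cij => /(_ _ e2) nij.
    move/cvgrPdist_le : cji => /(_ _ e2) nji.
    have nU : \forall z \near u, U z by exact: (open_nbhs_nbhs (conj oU Uu)).
    refine (@filterS3 _ (nbhs u) _ _ _ _ _ _ nU nij nji) => z Uz az bz.
    exact: And3 Uz az bz.
  by move=> /nbhs_ballP[d d0 H]; exists d.
(* two increments of size [h] stay in the ball of radius [d] *)
pose h := d / 3.
have h0 : 0 < h by rewrite divr_gt0.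
have bnd k l s r : `|s| <= `|h| -> `|r| <= `|h| ->
    ball u d (u + s *: delta_mx 0 k + r *: delta_mx 0 l).
  move=> sh rh; rewrite -ball_normE /= -addrA opprD addrA subrr sub0r normrN.
  apply: le_lt_trans (_ : `|h| + `|h| < d).
    apply: norm_row_le; rewrite ?addr_ge0// => q.
    rewrite !mxE eqxx /= (le_trans (ler_normD _ _))// lerD// normrM;
      by case: eqVneq => _; rewrite ?normr1 ?normr0 ?mulr1 ?mulr0.
  by rewrite gtr0_norm// /h -mulrDl ltr_pdivrMr//; nra.
have D k l s r (sh : `|s| <= `|h|) (rh : `|r| <= `|h|) :
   derivable f (u + s *: delta_mx 0 k + r *: delta_mx 0 l) (delta_mx 0 k) /\
   derivable (partial k f) (u + s *: delta_mx 0 k + r *: delta_mx 0 l)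
     (delta_mx 0 l).
  have [Uz _ _] := H _ (bnd k l s r sh rh).
  by split; [have [_] := sf [::] _ Uz|have [_] := sf [:: k] _ Uz]; apply.
have [s [r [sh rh E1]]] := MVT_second_difference (D i j).
have [s' [r' [sh' rh' E2]]] := MVT_second_difference (D j i).
have E : partial j (partial i f) (u + s *: delta_mx 0 i + r *: delta_mx 0 j) =
         partial i (partial j f) (u + s' *: delta_mx 0 j + r' *: delta_mx 0 i).
  have hn : h != 0 by rewrite gt_eqF.
  have EE : f (u + h *: delta_mx 0 i + h *: delta_mx 0 j)
      - f (u + h *: delta_mx 0 i) - f (u + h *: delta_mx 0 j) + f u =
    f (u + h *: delta_mx 0 j + h *: delta_mx 0 i)
      - f (u + h *: delta_mx 0 j) - f (u + h *: delta_mx 0 i) + f u.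
    by rewrite [in LHS](addrAC u); congr (_ + _); exact: addrAC.
  by move: EE; rewrite E1 E2 => /(mulfI hn)/(mulfI hn).
have [_ _ L1] := H _ (bnd i j s r sh rh).
have [_ L2 _] := H _ (bnd j i s' r' sh' rh').
rewrite E in L1.
exact: dist_le_half L2 L1.
Qed.

(** * Functions of class C^k *)

(** Unlike [smooth_on], this description by successive partial derivatives lends
    itself to induction on the order of differentiation. *)
Fixpoint Ck (R : realType) (m k : nat) (U : set 'rV[R]_m)
    (f : 'rV[R]_m -> R) : Prop :=
  (forall u, U u -> {for u, continuous f}) /\
  if k is k'.+1 then forall i, (forall u, U u -> derivable f u (delta_mx 0 i)) /\
                               Ck k' U (partial i f)
  else True.

Lemma smooth_onP (R : realType) (m : nat) (U : set 'rV[R]_m)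
    (f : 'rV[R]_m -> R) : smooth_on U f <-> forall k, Ck k U f.
Proof.
split=> [sf k|Cf].
  elim: k f sf => [|k IH] f sf; split; do ?[by move=> u /(sf [::])[]|by []].
  move=> i; split; first by move=> u /(sf [::])[_]; apply.
  by apply: IH => s u Uu /=; have := sf (rcons s i) u Uu; rewrite foldr_rcons.
move=> s; have : Ck (size s).+1 U f by [].
elim/last_ind: s f {Cf} => [|s i IH] f; last first.
  by rewrite size_rcons foldr_rcons => -[_ /(_ i)[_ /IH]].
by move=> [cf df] u Uu; split; [exact: cf|move=> i; exact: (df i).1].
Qed.

Lemma CkW (R : realType) (m k : nat) (U : set 'rV[R]_m) (f : 'rV[R]_m -> R) :
  Ck k.+1 U f -> Ck k U f.
Proof.
elim: k f => [|k IH] f [cf df]; split => // i.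
by split; [exact: (df i).1|apply: IH; exact: (df i).2].
Qed.

Lemma Ck_eq (R : realType) (m k : nat) (U : set 'rV[R]_m)
    (f g : 'rV[R]_m -> R) : open U -> (forall u, U u -> f u = g u) ->
  Ck k U f -> Ck k U g.
Proof.
move=> oU; elim: k f g => [|k IH] f g fg [cf df];
  (have nfg u : U u -> \forall z \near u, f z = g z by
    by move=> Uu; apply: filterS (open_nbhs_nbhs (conj oU Uu)) => z /fg); split => //.
- move=> u Uu; rewrite /prop_for /continuous_at -fg//.
  exact: cvg_trans (near_eq_cvg (nfg u Uu)) (cf u Uu).
- move=> u Uu; rewrite /prop_for /continuous_at -fg//.
  exact: cvg_trans (near_eq_cvg (nfg u Uu)) (cf u Uu).
- move=> i; have [dfi Cfi] := df i; split => [u Uu|].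
    by apply: near_eq_derivable (dfi u Uu); exact: nfg.
  by apply: IH Cfi => u Uu; apply: near_eq_derive; exact: nfg.
Qed.

Lemma Ck_cst (R : realType) (m k : nat) (U : set 'rV[R]_m) (a : R) :
  Ck k U (cst a).
Proof.
elim: k a => [|k IH] a; split => //; do ?[by move=> u _; exact: cst_continuous].
move=> i; split; first by move=> u _; exact: derivable_cst.
have -> : partial i (cst a : 'rV[R]_m -> R) = cst 0.
  by apply/funext => u; rewrite /partial derive_cst.
exact: IH.
Qed.

Lemma CkD (R : realType) (m k : nat) (U : set 'rV[R]_m)
    (f g : 'rV[R]_m -> R) : open U -> Ck k U f -> Ck k U g ->
  Ck k U (fun u => f u + g u).
Proof.
move=> oU; elim: k f g => [|k IH] f g [cf df] [cg dg]; split => //;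
  do ?[by move=> u Uu; apply: continuousD; [exact: cf|exact: cg]].
move=> i; have [dfi Cfi] := df i; have [dgi Cgi] := dg i; split => [u Uu|].
  by apply: derivableD; [exact: dfi|exact: dgi].
apply: Ck_eq (IH _ _ Cfi Cgi) => // u Uu.
by rewrite /partial [RHS]deriveD//; [exact: dfi|exact: dgi].
Qed.

Lemma CkM (R : realType) (m k : nat) (U : set 'rV[R]_m)
    (f g : 'rV[R]_m -> R) : open U -> Ck k U f -> Ck k U g ->
  Ck k U (fun u => f u * g u).
Proof.
move=> oU; elim: k f g => [|k IH] f g Cf Cg; have [cf df] := Cf;
  have [cg dg] := Cg; split => //;
  do ?[by move=> u Uu; apply: continuousM; [exact: cf|exact: cg]].
move=> i; have [dfi Cfi] := df i; have [dgi Cgi] := dg i; split => [u Uu|].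
  by apply: derivableM; [exact: dfi|exact: dgi].
apply: Ck_eq (CkD oU (IH _ _ (CkW Cf) Cgi) (IH _ _ (CkW Cg) Cfi)) => // u Uu.
by rewrite /partial [RHS]deriveM//; [exact: dfi|exact: dgi].
Qed.

Lemma Ck_sum (R : realType) (m k : nat) (U : set 'rV[R]_m) (I : Type)
    (r : seq I) (f : I -> 'rV[R]_m -> R) : open U ->
  (forall i, Ck k U (f i)) -> Ck k U (fun u => \sum_(i <- r) f i u).
Proof.
move=> oU Cf; elim: r => [|i r IH].
  by apply: Ck_eq (Ck_cst k U 0) => // u _; rewrite big_nil.
by apply: Ck_eq (CkD oU (Cf i) IH) => // u _; rewrite big_cons.
Qed.

Lemma continuous_coord (R : realType) (T : topologicalType) (m : nat)
    (g : T -> 'rV[R]_m) (u : T) :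
  (forall j, {for u, continuous (fun v => g v 0 j)}) -> {for u, continuous g}.
Proof.
move=> cg; apply/cvgrPdist_le => e e0.
have : \forall z \near u, forall j, `|g u 0 j - g z 0 j| <= e.
  refine (@filter_forall _ _ (fun (j : 'I_m) z => `|g u 0 j - g z 0 j| <= e)
    (nbhs u) _ _) => j.
  by have /cvgrPdist_le := cg j; apply.
apply: filterS => z H; apply: norm_row_le; first exact: ltW.
by move=> j; rewrite !mxE.
Qed.

(** By induction on [k]: the partial derivatives of [f \o g] are sums of
    products of functions of the same kind, of class C^(k-1). *)
Lemma Ck_comp (R : realType) (m l k : nat) (U : set 'rV[R]_m)
    (V : set 'rV[R]_l) (g : 'rV[R]_m -> 'rV[R]_l) (f : 'rV[R]_l -> R) :
  open U -> open V -> (forall u, U u -> V (g u)) ->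
  (forall j, Ck k U (fun u => g u 0 j)) -> Ck k V f -> Ck k U (f \o g).
Proof.
move=> oU oV gUV.
have ccomp (h : 'rV[R]_l -> R) : (forall j u, U u -> {for u, continuous (fun v => g v 0 j)}) ->
    (forall v, V v -> {for v, continuous h}) ->
    forall u, U u -> {for u, continuous (h \o g)}.
  move=> cg ch u Uu; apply: continuous_comp; last by apply: ch; exact: gUV.
  by apply: continuous_coord => j; exact: cg.
elim: k f => [|k IH] f Cg Cf.
  split; last exact: I.
  by apply: ccomp Cf.1 => j u Uu; have [cg _] := Cg j; exact: cg.
have [cf df] := Cf.
have D u i : U u -> is_derive u (delta_mx 0 i) (f \o g)
    (\sum_j partial j f (g u) * partial i (fun v => g v 0 j) u).
  move=> Uu; apply: is_derive_curve => j.
  - by have [_ /(_ i)[+ _]] := Cg j; apply.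
  - apply: filterS (open_nbhs_nbhs (conj oV (gUV _ Uu))) => z Vz.
    exact: (df j).1.
  - have [_ Cj] := df j; have cj : forall v, V v -> {for v, continuous (partial j f)}.
      by case: (k) Cj => [|k'] [].
    by apply: cj; exact: gUV.
split.
  apply: ccomp cf => j u Uu; by have [cg _] := Cg j; exact: cg.
move=> i; split; first by move=> u Uu; have [] := D u i Uu.
have E u : U u -> \sum_j partial j f (g u) * partial i (fun v => g v 0 j) u =
   partial i (f \o g) u by move=> Uu; have [_ <-] := D u i Uu.
apply: (Ck_eq oU E); apply: Ck_sum => // j; apply: CkM => //.
  by apply: (IH (partial j f)); [move=> j'; exact: CkW|exact: (df j).2].
by have [_ /(_ i)[]] := Cg j.
Qed.

Lemma smooth_on_comp (R : realType) (m l : nat) (U : set 'rV[R]_m)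
    (V : set 'rV[R]_l) (g : 'rV[R]_m -> 'rV[R]_l) (f : 'rV[R]_l -> R) :
  open U -> open V -> (forall u, U u -> V (g u)) ->
  smooth_map_on U g -> smooth_on V f -> smooth_on U (f \o g).
Proof.
move=> oU oV gUV sg /smooth_onP Cf; apply/smooth_onP => k.
by apply: Ck_comp oU oV gUV _ (Cf k) => j; have /smooth_onP := sg j; apply.
Qed.

Lemma smooth_on_eq (R : realType) (m : nat) (U : set 'rV[R]_m)
    (f g : 'rV[R]_m -> R) : open U -> (forall u, U u -> f u = g u) ->
  smooth_on U f -> smooth_on U g.
Proof.
move=> oU fg /smooth_onP Cf; apply/smooth_onP => k.
exact: Ck_eq oU fg (Cf k).
Qed.

(** * Transport of charts *)

Lemma chart_open_image (R : realType) (T : topologicalType) (m : nat)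
    (c : chart R T m) (O : set T) : is_chart c -> open O ->
  open (cmap c @` (cdom c `&` O)).
Proof.
case=> oc oi ck _ cc oO; rewrite openE => _ [x [cx Ox] <-].
have iu : cimg c (cmap c x) by exists x.
have n1 : nbhs (cmap c x) (cimg c) by exact: (open_nbhs_nbhs (conj oi iu)).
have n2 : nbhs (cmap c x) (cinv c @^-1` O).
  apply: (cc _ iu); rewrite ck//; exact: (open_nbhs_nbhs (conj oO Ox)).
apply: filterS2 n1 n2 => _ [y cy <-] /=; rewrite ck// => Oy.
by exists y.
Qed.

(** Local expressions of a composite compose, so that smoothness of [G \o F]
    can be read in the charts [c] and [d] as soon as it can be read through
    an intermediate chart [c']. *)
Lemma smooth_map_on_chart_comp (R : realType) (m l k : nat)
    (T1 T2 T3 : topologicalType)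
    (c : chart R T1 m) (c' : chart R T2 l) (d : chart R T3 k)
    (F : T1 -> T2) (G : T2 -> T3) :
  is_chart c -> is_chart c' -> is_chart d -> continuous F -> continuous G ->
  smooth_map_on (cmap c @` (cdom c `&` F @^-1` cdom c'))
    (fun u => cmap c' (F (cinv c u))) ->
  smooth_map_on (cmap c' @` (cdom c' `&` G @^-1` cdom d))
    (fun u => cmap d (G (cinv c' u))) ->
  smooth_map_on (cmap c @` (cdom c `&` F @^-1` (cdom c' `&` G @^-1` cdom d)))
    (fun u => cmap d (G (F (cinv c u)))).
Proof.
move=> hc hc' hd cF cG sF sG j.
set W := cmap c @` _; set V := cmap c' @` _ in sG.
have [_ _ ck _ _] := hc; have [od _ _ _ _] := hd; have [oc' _ ck' _ _] := hc'.
have oG : open (G @^-1` cdom d) by move/continuousP : cG; apply.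
have oW : open W.
  apply: chart_open_image => //; move/continuousP : (cF); apply.
  exact: openI.
have oV : open V by exact: chart_open_image.
have WV u : W u -> V (cmap c' (F (cinv c u))).
  by move=> [x [cx [c'x dx]] <-]; rewrite ck//; exists (F x).
apply: smooth_on_eq (smooth_on_comp oW oV WV _ (sG j)) => //.
  by move=> _ [x [cx [c'x dx]] <-] /=; rewrite ck// ck'.
move=> i s u [x [cx [c'x dx]] <-]; apply: (sF i s).
by exists x.
Qed.

Lemma hol_chart_smooth (R : realType) (n : nat) (X : cmanifold R n)
    (c : chart R X (n + n)) : hol_chart c -> smooth_chart c.
Proof.
have H U (f : 'rV[R]_(n + n) -> 'rV[R]_(n + n)) :
    holomorphic_map_on U f -> smooth_map_on U f.
  move=> hf j; case: (split_ordP j) => i ->.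
    by have [[]] := hf i.
  by have [[]] := hf i.
by case=> hc hd; split => // d /hd [h1 h2]; split; exact: H.
Qed.

Lemma cimg_push_chart (R : realType) (T T' : Type) (m : nat)
    (F : T -> T') (G : T' -> T) (c : chart R T m) :
  cancel F G -> cimg (push_chart F G c) = cimg c.
Proof.
move=> FK; apply/seteqP; split => [_ [_ [x cx <-] <-]|_ [x cx <-]] /=.
  by rewrite FK; exists x.
by exists (F x); [exists x|rewrite /= FK].
Qed.

Lemma image_cancel (T T' : Type) (F : T -> T') (G : T' -> T) (A : set T) :
  cancel F G -> cancel G F -> F @` A = G @^-1` A.
Proof.
move=> FK GK; apply/seteqP; split => [_ [x Ax <-]|y Ay] /=; first by rewrite FK.
by exists (G y).
Qed.

(** The change of coordinates between the transported chart and a chart of the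
    atlas of [Y] passes through [F] or [G], whose smoothness is only known in
    charts of the atlas of [X]; such a chart around the point considered serves
    as intermediate chart. *)
Lemma push_chart_smooth (R : realType) (m : nat) (X Y : manifold R m)
    (F : X -> Y) (G : Y -> X) (c : chart R X m) :
  smooth_map F -> smooth_map G -> cancel F G -> cancel G F ->
  smooth_chart c -> smooth_chart (push_chart F G c).
Proof.
move=> [cF sF] [cG sG] FK GK [hc sc].
have hp : is_chart (push_chart F G c).
  have [oc oi ck cc cic] := hc; split.
  - by rewrite /= (image_cancel _ FK GK); move/continuousP : cG; apply.
  - by rewrite (cimg_push_chart _ FK).
  - by move=> _ [x cx <-] /=; rewrite FK ck.
  - move=> _ [x cx <-] /=; apply: continuous_comp; first exact: cG.
    by rewrite FK; exact: cc.
  - rewrite (cimg_push_chart _ FK) => u cu; apply: continuous_comp; last exact: cF.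
    exact: cic.
split => // d ad.
have hd := m_chart ad; have [_ _ ck _ _] := hc; have [_ _ dk _ _] := hd.
have cid : continuous (@idfun X) by move=> ?; exact: cvg_id.
split=> j s _ [y + <-].
- move=> [[x cx <-] dx] /=; have [c' [ac' c'x]] := m_cover x.
  have hc' := m_chart ac'.
  apply: (smooth_map_on_chart_comp (F := idfun) hc hc' hd cid cF _ (sF _ _ ac' ad)).
    exact: (sc _ ac').1.
  by rewrite FK; exists x.
- move=> [dy [x cx xy]] /=; have [c' [ac' c'x]] := m_cover x.
  have hc' := m_chart ac'; rewrite -xy.
  apply: (smooth_map_on_chart_comp (G := idfun) hd hc' hc cG cid (sG _ _ ad ac')).
    exact: (sc _ ac').2.
  by exists (F x); rewrite /= ?FK//; split; rewrite ?xy.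
Qed.

(** * First-order expansion of the extension map *)

(** Real and imaginary parts are differentiated separately, as [derivable] would
    ask for a normed space structure on [R[i]] over [R]. *)
Definition has_deriv0 (R : realType) (f : R -> R[i]) (d : R[i]) : Prop :=
  is_derive (0 : R) 1 (fun t => complex.Re (f t)) (complex.Re d) /\
  is_derive (0 : R) 1 (fun t => complex.Im (f t)) (complex.Im d).

Definition has_ext_deriv0 (R : realType) (m : nat) (f : R -> ext R m)
    (d : ext R m) : Prop := forall S, has_deriv0 (fun t => f t S) (d S).

Section Deriv0.
Context {R : realType}.
Implicit Types (f g : R -> R[i]) (d e : R[i]).

Lemma has_deriv0_deriv0 f d : has_deriv0 f d -> Defs.deriv0 f = d.
Proof.
case=> [[_ d1] [_ d2]]; rewrite /Defs.deriv0 !derive1E d1 d2.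
by case: d {d1 d2}.
Qed.

Lemma has_deriv0_near f g d : (\forall t \near (0 : R), f t = g t) ->
  has_deriv0 f d -> has_deriv0 g d.
Proof.
move=> fg [d1 d2]; split.
  by apply: near_eq_is_derive d1; apply: filterS fg => t ->.
by apply: near_eq_is_derive d2; apply: filterS fg => t ->.
Qed.

Lemma has_deriv0_cst d : has_deriv0 (fun=> d) 0.
Proof. by split; exact: is_derive_cst. Qed.

Lemma has_deriv0D f g d e : has_deriv0 f d -> has_deriv0 g e ->
  has_deriv0 (fun t => f t + g t) (d + e).
Proof.
move=> [df1 df2] [dg1 dg2]; split.
  have -> : (fun t => complex.Re (f t + g t)) =
    (fun t => complex.Re (f t)) + (fun t => complex.Re (g t)).
    by apply/funext => t; rewrite [RHS]/= raddfD.
  by rewrite raddfD; exact: is_deriveD.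
have -> : (fun t => complex.Im (f t + g t)) =
    (fun t => complex.Im (f t)) + (fun t => complex.Im (g t)).
  by apply/funext => t; rewrite [RHS]/= raddfD.
by rewrite raddfD; exact: is_deriveD.
Qed.

Lemma ReD (x y : R[i]) : complex.Re (x + y) = complex.Re x + complex.Re y.
Proof. by case: x; case: y. Qed.

Lemma ImD (x y : R[i]) : complex.Im (x + y) = complex.Im x + complex.Im y.
Proof. by case: x; case: y. Qed.

Lemma ReM (x y : R[i]) : complex.Re (x * y) =
  complex.Re x * complex.Re y - complex.Im x * complex.Im y.
Proof. by case: x; case: y. Qed.

Lemma ImM (x y : R[i]) : complex.Im (x * y) =
  complex.Re x * complex.Im y + complex.Im x * complex.Re y.
Proof. by case: x; case: y. Qed.

Lemma has_deriv0M f g d e : has_deriv0 f d -> has_deriv0 g e ->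
  has_deriv0 (fun t => f t * g t) (d * g 0 + f 0 * e).
Proof.
have scaleR (x y : R) : x *: (y : R^o) = x * y by [].
move=> [df1 df2] [dg1 dg2]; split.
  have -> : (fun t => complex.Re (f t * g t)) =
    (fun t => complex.Re (f t)) * (fun t => complex.Re (g t)) -
    (fun t => complex.Im (f t)) * (fun t => complex.Im (g t)).
    by apply/funext => t; rewrite ReM.
  apply: (is_derive_eq (is_deriveB (is_deriveM df1 dg1) (is_deriveM df2 dg2))).
  rewrite ReD !ReM !scaleR.
  by move: (complex.Re d) (complex.Im d) (complex.Re e) (complex.Im e) => *; ring.
have -> : (fun t => complex.Im (f t * g t)) =
    (fun t => complex.Re (f t)) * (fun t => complex.Im (g t)) +
    (fun t => complex.Im (f t)) * (fun t => complex.Re (g t)).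
  by apply/funext => t; rewrite ImM.
apply: (is_derive_eq (is_deriveD (is_deriveM df1 dg2) (is_deriveM df2 dg1))).
rewrite ImD !ImM !scaleR.
by move: (complex.Re d) (complex.Im d) (complex.Re e) (complex.Im e) => *; ring.
Qed.

Lemma has_deriv0_sum (I : Type) (r : seq I) (P : pred I) (f : I -> R -> R[i])
    (d : I -> R[i]) : (forall i, P i -> has_deriv0 (f i) (d i)) ->
  has_deriv0 (fun t => \sum_(i <- r | P i) f i t) (\sum_(i <- r | P i) d i).
Proof.
move=> df; elim: r => [|i r IH].
  rewrite big_nil (_ : (fun _ => _) = (fun=> 0)); first exact: has_deriv0_cst.
  by apply/funext => t; rewrite big_nil.
rewrite big_cons; case: ifP => Pi.
  rewrite (_ : (fun _ => _) = (fun t => f i t + \sum_(i <- r | P i) f i t)).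
    by apply: has_deriv0D IH; exact: df.
  by apply/funext => t; rewrite big_cons Pi.
rewrite (_ : (fun _ => _) = (fun t => \sum_(i <- r | P i) f i t))//.
by apply/funext => t; rewrite big_cons Pi.
Qed.

Lemma has_deriv0Zl f d e : has_deriv0 f d -> has_deriv0 (fun t => e * f t) (e * d).
Proof.
by move=> df; have := has_deriv0M (has_deriv0_cst e) df; rewrite mul0r add0r.
Qed.

Lemma has_deriv0_conj f d : has_deriv0 f d ->
  has_deriv0 (fun t => conjc (f t)) (conjc d).
Proof.
have ReC (x : R[i]) : complex.Re (conjc x) = complex.Re x by case: x.
have ImC (x : R[i]) : complex.Im (conjc x) = - complex.Im x by case: x.
move=> [d1 d2]; split.
  by rewrite ReC (_ : (fun _ => _) = (fun t => complex.Re (f t)))//;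
    apply/funext => t; exact: ReC.
rewrite ImC (_ : (fun _ => _) = - (fun t => complex.Im (f t))).
  exact: is_deriveN.
by apply/funext => t; exact: ImC.
Qed.

End Deriv0.

Section ExtDeriv0.
Context {R : realType} {m : nat}.
Implicit Types (f g : R -> ext R m) (d e : ext R m).

Lemma has_ext_deriv0_eq f d e : has_ext_deriv0 f d -> d = e -> has_ext_deriv0 f e.
Proof. by move=> df <-. Qed.

Lemma has_ext_deriv0_cst d : has_ext_deriv0 (fun=> d) 0.
Proof. by move=> S; rewrite ffunE; exact: has_deriv0_cst. Qed.

Lemma has_ext_deriv0D f g d e : has_ext_deriv0 f d -> has_ext_deriv0 g e ->
  has_ext_deriv0 (fun t => f t + g t) (d + e).
Proof.
move=> df dg S; rewrite ffunE (_ : (fun _ => _) = (fun t => f t S + g t S)).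
  exact: has_deriv0D.
by apply/funext => t; rewrite ffunE.
Qed.

Lemma has_ext_deriv0_sum (I : Type) (r : seq I) (f : I -> R -> ext R m)
    (d : I -> ext R m) : (forall i, has_ext_deriv0 (f i) (d i)) ->
  has_ext_deriv0 (fun t => \sum_(i <- r) f i t) (\sum_(i <- r) d i).
Proof.
move=> df S; rewrite sum_ffunE.
rewrite (_ : (fun _ => _) = (fun t => \sum_(i <- r) f i t S)).
  by apply: has_deriv0_sum => i _; exact: df.
by apply/funext => t; rewrite sum_ffunE.
Qed.

Lemma has_ext_deriv0Z (k : R -> R[i]) k' f d : has_deriv0 k k' ->
  has_ext_deriv0 f d ->
  has_ext_deriv0 (fun t => (k t : R[i]) *: f t) (k' *: f 0 + k 0 *: d).
Proof.
move=> dk df S; rewrite !ffunE (_ : (fun _ => _) = (fun t => k t * f t S)).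
  exact: has_deriv0M dk (df S).
by apply/funext => t; rewrite ffunE.
Qed.

Lemma has_ext_deriv0_wedge f g d e : has_ext_deriv0 f d -> has_ext_deriv0 g e ->
  has_ext_deriv0 (fun t => wedge (f t) (g t)) (wedge d (g 0) + wedge (f 0) e).
Proof.
move=> df dg S; rewrite !ffunE -big_split /=.
rewrite (_ : (fun _ => _) = (fun t => \sum_(A : {set 'I_m} | A \subset S)
     shuffle_sign R A (S :\: A)%SET * f t A * g t (S :\: A)%SET)); last first.
  by apply/funext => t; rewrite ffunE.
apply: has_deriv0_sum => A _.
exact: has_deriv0M (has_deriv0Zl _ (df A)) (dg _).
Qed.

Lemma has_ext_deriv0_interior s f d : has_ext_deriv0 f d ->
  has_ext_deriv0 (fun t => interior_prod s (f t)) (interior_prod s d).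
Proof.
move=> df S; rewrite ffunE; case: ifP => sS.
  rewrite (_ : (fun _ => _) = (fun=> 0)); first exact: has_deriv0_cst.
  by apply/funext => t; rewrite ffunE sS.
rewrite (_ : (fun _ => _) = (fun t => (-1) ^+ #|[set j in S | (j < s)%N]%SET| *
   f t (s |: S)%SET)); first exact: has_deriv0Zl (df _).
by apply/funext => t; rewrite ffunE sS.
Qed.

End ExtDeriv0.

Section ContractionDeriv0.
Context {R : realType} {n : nat}.
Implicit Types (A : R -> 'M[R[i]]_n) (B : 'M[R[i]]_n) (g : R -> ext R (n + n)).

(** The derivative of [g] does not show up because it is contracted with
    [A 0 = 0]; the same holds for the conjugate contraction. *)
Lemma has_ext_deriv0_iota_v A B g d : A 0 = 0 ->
  (forall l k, has_deriv0 (fun t => A t l k) (B l k)) -> has_ext_deriv0 g d ->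
  has_ext_deriv0 (fun t => iota_v (A t) (g t)) (iota_v B (g 0)).
Proof.
move=> A0 dA dg; apply: has_ext_deriv0_sum => l.
apply: has_ext_deriv0_eq.
  apply: has_ext_deriv0_wedge; last exact: has_ext_deriv0_interior dg.
  apply: (@has_ext_deriv0_sum _ _ _ _ (fun k t => (A t l k : R[i]) *: dzbar R k)
    (fun k => (B l k : R[i]) *: dzbar R k)) => k.
  apply: has_ext_deriv0_eq (has_ext_deriv0Z (dA l k) (has_ext_deriv0_cst _)) _.
  by rewrite scaler0 addr0.
have -> : vcomp (A 0) l = 0.
  by rewrite /vcomp big1// => k _; rewrite A0 mxE scale0r.
by rewrite wedge0r addr0.
Qed.

Lemma has_ext_deriv0_iota_vbar A B g d : A 0 = 0 ->
  (forall l k, has_deriv0 (fun t => A t l k) (B l k)) -> has_ext_deriv0 g d ->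
  has_ext_deriv0 (fun t => iota_vbar (A t) (g t)) (iota_vbar B (g 0)).
Proof.
move=> A0 dA dg; apply: has_ext_deriv0_sum => l.
apply: has_ext_deriv0_eq.
  apply: has_ext_deriv0_wedge; last exact: has_ext_deriv0_interior dg.
  apply: (@has_ext_deriv0_sum _ _ _ _ (fun k t => (conjc (A t l k) : R[i]) *: dz R k)
    (fun k => (conjc (B l k) : R[i]) *: dz R k)) => k.
  apply: has_ext_deriv0_eq
    (has_ext_deriv0Z (has_deriv0_conj (dA l k)) (has_ext_deriv0_cst _)) _.
  by rewrite scaler0 addr0.
have -> : \sum_k (conjc (A 0 l k) : R[i]) *: dz R k = 0 :> ext R (n + n).
  by rewrite big1// => k _; rewrite A0 mxE conjc0 scale0r.
by rewrite wedge0r addr0.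
Qed.

Lemma exp_nilp0 (f : ext R (n + n) -> ext R (n + n)) a :
  (forall b, f b = 0) -> exp_nilp f a = a.
Proof.
move=> f0; rewrite /exp_nilp big_ord_recl big1 => [|i _].
  by rewrite addr0 /= fact0 invr1 scale1r.
by rewrite /= f0 scaler0.
Qed.

(** To first order in [t], [exp (f t) = 1 + f t] when [f 0 = 0]: every higher
    iterate of [f t] vanishes to second order. *)
Lemma has_ext_deriv0_exp_nilp (f : R -> ext R (n + n) -> ext R (n + n))
    (f' : ext R (n + n) -> ext R (n + n)) a : (0 < n)%N ->
  f' 0 = 0 -> (forall b, f 0 b = 0) ->
  (forall g d, has_ext_deriv0 g d ->
     has_ext_deriv0 (fun t => f t (g t)) (f' (g 0))) ->
  has_ext_deriv0 (fun t => exp_nilp (f t) a) (f' a).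
Proof.
move=> n0 f'0 f0 df.
have diter k : has_ext_deriv0 (fun t => iter k (f t) a)
    (if k is k'.+1 then if k' is 0 then f' a else 0 else 0).
  elim: k => [|k IH]; first exact: has_ext_deriv0_cst.
  apply: has_ext_deriv0_eq (df _ _ IH) _.
  by case: k {IH} => //= k; rewrite f0.
apply: has_ext_deriv0_eq; first apply: has_ext_deriv0_sum => k.
  exact: has_ext_deriv0Z (has_deriv0_cst _) (diter k).
case: n n0 f f' a f'0 f0 df diter => [//|n' _] f f' a f'0 f0 df diter.
rewrite 2!big_ord_recl big1 => [|i _]; last by rewrite /= scale0r scaler0 addr0.
rewrite /= !scale0r scaler0 !add0r addr0.
by rewrite (_ : bump 0 0 = 1%N)// factS fact0 muln1 invr1 scale1r.
Qed.

(** The product rule gives three terms, according to which of the coefficients,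
    the dz's and the dzbar's is differentiated. *)
Lemma has_ext_deriv0_ext_exp A B (w : R -> ext R (n + n)) w' : (0 < n)%N ->
  A 0 = 0 -> (forall l k, has_deriv0 (fun t => A t l k) (B l k)) ->
  has_ext_deriv0 w w' ->
  has_ext_deriv0 (fun t => ext_exp (A t) (w t))
    (w' + (iota_v B (w 0) +
     \sum_(S : {set 'I_(n + n)}) w 0 S *:
        wedge (ebasis (S :&: dz_indices n)%SET)
              (iota_vbar B (ebasis (S :\: dz_indices n)%SET)))).
Proof.
move=> n0 A0 dA dw.
pose P (S : {set 'I_(n + n)}) := (S :&: dz_indices n)%SET.
pose Q (S : {set 'I_(n + n)}) := (S :\: dz_indices n)%SET.
have PD S : P S \subset dz_indices n by exact: dz_split_sub.
have QD S : [disjoint Q S & dz_indices n]%B by exact: dz_split_disjoint.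
have PQ S : (P S :|: Q S)%SET = S by exact: setID.
have i0 b : iota_v (A 0) b = 0 by rewrite A0 iota_v0l.
have ib0 b : iota_vbar (A 0) b = 0 by rewrite A0 iota_vbar0l.
have z1 : iota_v B 0 = 0.
  by rewrite /iota_v big1// => l _; rewrite -(scale0r 0) interior_prodZ !scale0r wedger0.
have z2 : iota_vbar B 0 = 0.
  by rewrite /iota_vbar big1// => l _; rewrite -(scale0r 0) interior_prodZ !scale0r wedger0.
apply: has_ext_deriv0_eq.
  apply: (has_ext_deriv0_sum) => S.
  apply: has_ext_deriv0Z (dw S) _.
  apply: has_ext_deriv0_wedge.
    by apply: (@has_ext_deriv0_exp_nilp (fun t => iota_v (A t)) (iota_v B)
      (ebasis (P S)) n0 z1 i0) => g d; exact: has_ext_deriv0_iota_v.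
  by apply: (@has_ext_deriv0_exp_nilp (fun t => iota_vbar (A t)) (iota_vbar B)
    (ebasis (Q S)) n0 z2 ib0) => g d; exact: has_ext_deriv0_iota_vbar.
rewrite [in RHS](ext_decomp w') [in X in _ + (X + _)](ext_decomp (w 0)) iota_v_sum.
rewrite -!big_split /=; apply: eq_bigr => S _.
rewrite !(exp_nilp0 _ i0) !(exp_nilp0 _ ib0) (wedge_ebasis_dz (PD S) (QD S)).
by rewrite (iota_v_wedge_dz _ (PD S) (QD S)) (PQ S) scalerDr iota_vZ.
Qed.

Lemma ext_exp0 (a : ext R (n + n)) : ext_exp 0 a = a.
Proof.
rewrite [RHS]ext_decomp; apply: eq_bigr => S _.
rewrite (exp_nilp0 _ iota_v0l) (exp_nilp0 _ iota_vbar0l).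
by rewrite wedge_ebasis_dz ?setID// ?dz_split_sub ?dz_split_disjoint.
Qed.

End ContractionDeriv0.

(** * Smooth families of functions and differentiation in the parameter *)

Section Slices.
Context {R : realType} {m : nat}.
Implicit Types (F : 'rV[R]_(1 + m) -> R) (u : 'rV[R]_m) (t : R) (i : 'I_m).

Definition slice_pt t u : 'rV[R]_(1 + m) := row_mx (const_mx t) u.

Lemma slice_ptDl t h u : slice_pt (h + t) u =
  h *: delta_mx 0 (lshift m ord0) + slice_pt t u.
Proof.
apply/rowP => j; rewrite [RHS]mxE.
case: (split_ordP j) => k ->; rewrite ?row_mxEl ?row_mxEr !mxE.
  by rewrite (ord1 k) eqxx mulr1.
by rewrite eq_rlshift mulr0 add0r.
Qed.

Lemma slice_ptDr t h u i : slice_pt t (h *: delta_mx 0 i + u) =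
  h *: delta_mx 0 (rshift 1 i) + slice_pt t u.
Proof.
apply/rowP => j; rewrite [RHS]mxE.
case: (split_ordP j) => k ->; rewrite ?row_mxEl ?row_mxEr !mxE.
  by rewrite eq_lrshift andbF mulr0 add0r.
by rewrite eq_rshift.
Qed.

(** Both sides are limits of the same difference quotients, as a coordinate
    line of the slice is a coordinate line of the product. *)
Lemma partial_slice F t u i :
  partial i (fun v => F (slice_pt t v)) u = partial (rshift 1 i) F (slice_pt t u).
Proof.
have E : (fun h : R => h^-1 *: (((fun v => F (slice_pt t v)) \o shift u)
             (h *: delta_mx 0 i) - F (slice_pt t u))) =
   (fun h : R => h^-1 *: ((F \o shift (slice_pt t u))
             (h *: delta_mx 0 (rshift 1 i)) - F (slice_pt t u))).
  by apply/funext => h /=; rewrite slice_ptDr.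
by rewrite /partial /derive E.
Qed.

Lemma is_derive_slice F t u : derivable F (slice_pt t u) (delta_mx 0 (lshift m ord0)) ->
  is_derive t 1 (fun s : R => F (slice_pt s u))
    (partial (lshift m ord0) F (slice_pt t u)).
Proof.
have E : (fun h : R => h^-1 *: (((fun s : R => F (slice_pt s u)) \o shift t)
             (h *: (1 : R)) - F (slice_pt t u))) =
   (fun h : R => h^-1 *: ((F \o shift (slice_pt t u))
             (h *: delta_mx 0 (lshift m ord0)) - F (slice_pt t u))).
  by apply/funext => h /=; rewrite [h%:A]mulr1 slice_ptDl.
by move=> dF; split; rewrite /partial ?/derivable ?/derive E.
Qed.

Variables (eps : R) (T : Type) (c : chart R T m).
Hypotheses (eps0 : 0 < eps) (oc : open (cimg c)).

Lemma base_img_open : open (base_img eps c).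
Proof.
pose f (v : 'rV[R]_(1 + m)) : R := lsubmx v 0 0.
have cf : continuous f.
  move=> v; apply: (@continuous_comp _ _ _ lsubmx (fun w : 'rV[R]_1 => w 0 0)).
    exact: continuous_lsubmx.
  exact: coord_continuous.
have -> : base_img eps c = (f @^-1` `]-eps, eps[) `&` (rsubmx @^-1` cimg c).
  by apply/seteqP; split => v; rewrite /base_img /base /= in_itv.
apply: openI.
  by move/continuousP : cf; apply; exact: itv_open.
by move/continuousP : (@continuous_rsubmx R 1 1 m); apply.
Qed.

Lemma base0 : base eps 0.
Proof. by rewrite /base /= eps0 oppr_lt0 eps0. Qed.

Lemma near0_base : \forall t \near (0 : R), base eps t.
Proof.
have -> : base eps = `]-eps, eps[%classic.
  by apply/seteqP; split => v; rewrite /base /= in_itv.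
apply: open_nbhs_nbhs; split; first exact: itv_open.
by rewrite /= in_itv /= eps0 oppr_lt0 eps0.
Qed.

Lemma base_img_slice u : cimg c u -> base_img eps c (slice_pt 0 u).
Proof.
by move=> cu; rewrite /base_img /= row_mxKl row_mxKr mxE; split => //; exact: base0.
Qed.

Lemma is_derive_smooth_slice F u : smooth_on (base_img eps c) F -> cimg c u ->
  is_derive (0 : R) 1 (fun t : R => F (slice_pt t u)) (derive1 (fun t : R => F (slice_pt t u)) 0).
Proof.
move=> sF cu; rewrite derive1E; apply: derivableP.
have [_ dF] := sF [::] _ (base_img_slice cu).
by have [] := is_derive_slice (dF (lshift m ord0)).
Qed.

(** Differentiation in the parameter commutes with differentiation along the
    slice, because mixed second partial derivatives agree. *)
Lemma is_derive_partial_slice F u i :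
  smooth_on (base_img eps c) F -> cimg c u ->
  is_derive (0 : R) 1 (fun t : R => partial i (fun v => F (slice_pt t v)) u)
    (partial i (fun v => derive1 (fun t : R => F (slice_pt t v)) 0) u).
Proof.
move=> sF cu; pose i0 : 'I_(1 + m) := lshift m ord0; pose k := rshift 1 i.
have -> : (fun t : R => partial i (fun v => F (slice_pt t v)) u) =
          (fun t : R => partial k F (slice_pt t u)).
  by apply/funext => t; exact: partial_slice.
have [_ dF] := sF [:: k] _ (base_img_slice cu).
have D := is_derive_slice (dF i0).
have C := partial_comm i0 k base_img_open sF (base_img_slice cu).
have S := partial_slice (partial i0 F) 0 u i.
have N : partial i (fun v => partial i0 F (slice_pt 0 v)) u =
         partial i (fun v => derive1 (fun t : R => F (slice_pt t v)) 0) u.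
  apply: near_eq_derive; apply: filterS (open_nbhs_nbhs (conj oc cu)) => v cv.
  have [_ dFv] := sF [::] _ (base_img_slice cv).
  have [_ E] := is_derive_slice (dFv i0).
  by rewrite derive1E E.
by rewrite -N S -/k -C.
Qed.

End Slices.

Section SmoothFamilies.
Context {R : realType} {n : nat} {T : Type}.
Variables (eps : R) (c : chart R T (n + n)) (f : R -> 'rV[R]_(n + n) -> R[i]).
Hypotheses (eps0 : 0 < eps) (oc : open (cimg c)).
Hypothesis sf :
  smoothC_on (base_img eps c) (fun v => f (lsubmx v 0 0) (rsubmx v)).
Variables (u : 'rV[R]_(n + n)) (cu : cimg c u).

Let slice_f t v : f (lsubmx (slice_pt t v) 0 0) (rsubmx (slice_pt t v)) = f t v.
Proof. by rewrite /slice_pt row_mxKl row_mxKr mxE. Qed.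

Lemma has_deriv0_family :
  has_deriv0 (fun t => f t u) (Defs.deriv0 (fun t => f t u)).
Proof.
have [s1 s2] := sf.
have d1 := is_derive_smooth_slice eps0 s1 cu.
have d2 := is_derive_smooth_slice eps0 s2 cu.
split; [move: d1|move: d2].
  rewrite (_ : (fun t : R => _) = (fun t : R => complex.Re (f t u)))//.
  by apply/funext => t /=; rewrite slice_f.
rewrite (_ : (fun t : R => _) = (fun t : R => complex.Im (f t u)))//.
by apply/funext => t /=; rewrite slice_f.
Qed.

Lemma has_deriv0_partialC i : has_deriv0 (fun t => partialC i (f t) u)
  (partialC i (fun v => Defs.deriv0 (fun t => f t v)) u).
Proof.
have [s1 s2] := sf.
have d1 := is_derive_partial_slice eps0 oc i s1 cu.
have d2 := is_derive_partial_slice eps0 oc i s2 cu.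
split; [move: d1|move: d2].
- rewrite (_ : (fun t : R => partial i _ u) = (fun t => complex.Re (partialC i (f t) u))).
    rewrite (_ : (fun v => derive1 _ 0) = (fun v => complex.Re (Defs.deriv0 (fun t => f t v)))) //.
    by apply/funext => v /=; congr (derive1 _ 0); apply/funext => t; rewrite slice_f.
  by apply/funext => t /=; congr (partial i _ u); apply/funext => v; rewrite slice_f.
- rewrite (_ : (fun t : R => partial i _ u) = (fun t => complex.Im (partialC i (f t) u))).
    rewrite (_ : (fun v => derive1 _ 0) = (fun v => complex.Im (Defs.deriv0 (fun t => f t v)))) //.
    by apply/funext => v /=; congr (derive1 _ 0); apply/funext => t; rewrite slice_f.
  by apply/funext => t /=; congr (partial i _ u); apply/funext => v; rewrite slice_f.
Qed.

Lemma has_deriv0_d_z j : has_deriv0 (fun t => d_z j (f t) u)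
  (d_z j (fun v => Defs.deriv0 (fun t => f t v)) u).
Proof.
apply: has_deriv0Zl; apply: has_deriv0D; first exact: has_deriv0_partialC.
by rewrite -mulNr; under eq_fun do rewrite -mulNr;
  apply: has_deriv0Zl; exact: has_deriv0_partialC.
Qed.

Lemma has_deriv0_d_zbar j : has_deriv0 (fun t => d_zbar j (f t) u)
  (d_zbar j (fun v => Defs.deriv0 (fun t => f t v)) u).
Proof.
apply: has_deriv0Zl; apply: has_deriv0D; first exact: has_deriv0_partialC.
by apply: has_deriv0Zl; exact: has_deriv0_partialC.
Qed.

End SmoothFamilies.

(** * Closed families and components of the exterior derivative *)

Section LocalForms.
Context {R : realType} {n : nat}.
Variables (U : set 'rV[R]_(n + n)) (u : 'rV[R]_(n + n)).
Hypotheses (oU : open U) (Uu : U u).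
Implicit Types (f g : 'rV[R]_(n + n) -> R[i]) (w : 'rV[R]_(n + n) -> ext R (n + n)).

Lemma partialC_local i f g : (forall v, U v -> f v = g v) ->
  partialC i f u = partialC i g u.
Proof.
move=> fg; have N := open_nbhs_nbhs (conj oU Uu).
congr Complex; apply: near_eq_derive; apply: filterS N => v /fg ->//.
Qed.

Lemma d_z_local j f g : (forall v, U v -> f v = g v) -> d_z j f u = d_z j g u.
Proof. by move=> fg; rewrite /d_z !(partialC_local _ fg). Qed.

Lemma d_zbar_local j f g : (forall v, U v -> f v = g v) ->
  d_zbar j f u = d_zbar j g u.
Proof. by move=> fg; rewrite /d_zbar !(partialC_local _ fg). Qed.

Lemma partialC0 i : partialC i (fun=> 0 : R[i]) u = 0.
Proof. by rewrite /partialC /partial /= derive_cst. Qed.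

(** [D] stands for [d_z j] or [d_zbar j], which are local and kill the zero
    function. *)
Lemma has_type_dcoef (D : ('rV[R]_(n + n) -> R[i]) -> 'rV[R]_(n + n) -> R[i])
    p q w : D (fun=> 0) u = 0 ->
  (forall f g, (forall v, U v -> f v = g v) -> D f u = D g u) ->
  (forall v, U v -> has_type p q (w v)) -> has_type p q (dcoef D w u).
Proof.
move=> D0 DU tw S; rewrite ffunE => wS.
have [[-> ->]//|nS] := eqVneq (#|(S :&: dz_indices n)%SET|, #|(S :\: dz_indices n)%SET|) (p, q).
case/eqP: wS; rewrite -[RHS]D0; apply: DU => v Uv.
exact: has_type_coef0 (tw v Uv) nS.
Qed.

Lemma has_type_del p q w : (forall v, U v -> has_type p q (w v)) ->
  has_type p.+1 q (del w u).
Proof.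
move=> tw; apply: has_type_sum => j; rewrite -(add1n p) -(add0n q).
apply: has_type_wedge; first exact: has_type_dz.
apply: has_type_dcoef tw => [|f g]; last exact: d_z_local.
by rewrite /d_z !partialC0 mulr0 subr0 mulr0.
Qed.

Lemma has_type_delbar p q w : (forall v, U v -> has_type p q (w v)) ->
  has_type p q.+1 (delbar w u).
Proof.
move=> tw; apply: has_type_sum => j; rewrite -(add0n p) -(add1n q).
apply: has_type_wedge; first exact: has_type_dzbar.
apply: has_type_dcoef tw => [|f g]; last exact: d_zbar_local.
by rewrite /d_zbar !partialC0 mulr0 addr0 mulr0.
Qed.

(** The operator [del] raises p by 1 and [delbar] raises q by 1, so that the
    component of type (p, p+1) of [ext_d w] only sees the components of [w] of
    types (p-1, p+1) and (p, p). *)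
Lemma ext_d_component p w a b T :
  (forall v, U v -> has_type p.-1 p.+1 (a v)) ->
  (forall v, U v -> has_type p p (b v)) ->
  (forall v, U v -> exists2 c, has_type p.+1 p.-1 c & w v = b v + (a v + c)) ->
  (0 < p)%N ->
  (#|(T :&: dz_indices n)%SET|, #|(T :\: dz_indices n)%SET|) = (p, p.+1) ->
  ext_d w u T = del a u T + delbar b u T.
Proof.
move=> ta tb tw p0 tT.
have E1 : del w u T = del a u T.
  rewrite /del !sum_ffunE; apply: eq_bigr => j _.
  apply: wedge_ebasis1_coef => jT; rewrite [LHS]ffunE [RHS]ffunE.
  have := card_type_setD1 tT jT; rewrite lshift_dz => tS.
  apply: d_z_local => v Uv; have [c tc ->] := tw v Uv.
  rewrite ffunE [X in _ + X]ffunE (has_type_coef0 (tb v Uv)); last first.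
    by rewrite tS xpair_eqE; apply/negP => /andP[/eqP]; lia.
  rewrite (has_type_coef0 tc) ?addr0 ?add0r//.
  by rewrite tS xpair_eqE; apply/negP => /andP[/eqP]; lia.
have E2 : delbar w u T = delbar b u T.
  rewrite /delbar !sum_ffunE; apply: eq_bigr => j _.
  apply: wedge_ebasis1_coef => jT; rewrite [LHS]ffunE [RHS]ffunE.
  have := card_type_setD1 tT jT; rewrite (negbTE (rshift_dz j)) => tS.
  apply: d_zbar_local => v Uv; have [c tc ->] := tw v Uv.
  rewrite ffunE [X in _ + X]ffunE (has_type_coef0 (ta v Uv)); last first.
    by rewrite tS xpair_eqE; apply/negP => /andP[/eqP]; lia.
  rewrite (has_type_coef0 tc) ?addr0//.
  by rewrite tS xpair_eqE; apply/negP => /andP[/eqP]; lia.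
by rewrite -E1 -E2; exact: ffunE.
Qed.

End LocalForms.

(** A smooth chart of [M] transported by the trivialization is a smooth chart of
    the fibre, and a closed form on the fibre is closed in all smooth charts. *)
Lemma ext_d_on_M (R : realType) (n : nat) (eps : R) (M : cmanifold R n)
    (X : dfamily n eps) (Psi : trivialization M X) (t : R)
    (w : preform (fibre X t)) (c : chart R M (n + n)) (u : 'rV[R]_(n + n)) :
  base eps t -> closed_form w -> smooth_chart c -> cimg c u ->
  ext_d (on_M Psi w c) u = 0.
Proof.
move=> bt cw sc cu; apply: (cw (push_chart (triv Psi t) (triv_inv Psi t) c)).
  by apply: push_chart_smooth sc; [exact: triv_smooth|exact: triv_inv_smooth
    |exact: trivK|exact: triv_invK].
by rewrite cimg_push_chart//; exact: trivK.
Qed.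

Section ClosedFamily.
Context {R : realType} {n : nat} {T : Type}.
Variables (eps : R) (c : chart R T (n + n)).
Variable (w : R -> 'rV[R]_(n + n) -> ext R (n + n)).
Hypotheses (eps0 : 0 < eps) (oc : open (cimg c)).
Hypothesis sw : forall S,
  smoothC_on (base_img eps c) (fun v => w (lsubmx v 0 0) (rsubmx v) S).

Definition ext_deriv0 (v : 'rV[R]_(n + n)) : ext R (n + n) :=
  [ffun S => Defs.deriv0 (fun t => w t v S)].

Lemma has_ext_deriv0_family u : cimg c u ->
  has_ext_deriv0 (fun t => w t u) (ext_deriv0 u).
Proof.
move=> cu S; rewrite ffunE.
exact: (has_deriv0_family (f := fun t v => w t v S) eps0 (sw S) cu).
Qed.

Lemma has_ext_deriv0_d_z u j : cimg c u ->
  has_ext_deriv0 (fun t => dcoef (d_z j) (w t) u) (dcoef (d_z j) ext_deriv0 u).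
Proof.
move=> cu S; rewrite ffunE.
have -> : (fun v => ext_deriv0 v S) = (fun v => Defs.deriv0 (fun t => w t v S)).
  by apply/funext => v; rewrite ffunE.
have -> : (fun t => dcoef (d_z j) (w t) u S) =
          (fun t => d_z j (fun v => w t v S) u).
  by apply/funext => t; rewrite ffunE.
exact: (has_deriv0_d_z (f := fun t v => w t v S) eps0 oc (sw S) cu j).
Qed.

Lemma has_ext_deriv0_d_zbar u j : cimg c u ->
  has_ext_deriv0 (fun t => dcoef (d_zbar j) (w t) u)
    (dcoef (d_zbar j) ext_deriv0 u).
Proof.
move=> cu S; rewrite ffunE.
have -> : (fun v => ext_deriv0 v S) = (fun v => Defs.deriv0 (fun t => w t v S)).
  by apply/funext => v; rewrite ffunE.
have -> : (fun t => dcoef (d_zbar j) (w t) u S) =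
          (fun t => d_zbar j (fun v => w t v S) u).
  by apply/funext => t; rewrite ffunE.
exact: (has_deriv0_d_zbar (f := fun t v => w t v S) eps0 oc (sw S) cu j).
Qed.

Lemma has_ext_deriv0_wedgel (a : ext R (n + n)) g e : has_ext_deriv0 g e ->
  has_ext_deriv0 (fun t => wedge a (g t)) (wedge a e).
Proof.
move=> dg; apply: has_ext_deriv0_eq (has_ext_deriv0_wedge (has_ext_deriv0_cst a) dg) _.
by rewrite wedge0r add0r.
Qed.

(** [ext_d (w t) u = 0] may be differentiated in [t] under [ext_d]. *)
Lemma ext_d_ext_deriv0 u : cimg c u ->
  (forall t, base eps t -> ext_d (w t) u = 0) -> ext_d ext_deriv0 u = 0.
Proof.
move=> cu dw.
have H : has_ext_deriv0 (fun t => ext_d (w t) u) (ext_d ext_deriv0 u).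
  apply: has_ext_deriv0D; apply: has_ext_deriv0_sum => j;
    apply: has_ext_deriv0_wedgel.
  - exact: has_ext_deriv0_d_z.
  - exact: has_ext_deriv0_d_zbar.
apply/ffunP => S; rewrite [RHS]ffunE -(has_deriv0_deriv0 (H S)).
apply: has_deriv0_deriv0; apply: has_deriv0_near (has_deriv0_cst 0).
apply: filterS (near0_base eps0) => t bt.
by rewrite dw// ffunE.
Qed.

End ClosedFamily.

(** Every coefficient off the type (p, q) vanishes for all parameters close to
    0. *)
Lemma has_type_ext_deriv0 (R : realType) (n p q : nat) (eps : R)
    (w : R -> 'rV[R]_(n + n) -> ext R (n + n)) (v : 'rV[R]_(n + n)) :
  0 < eps -> (forall t, base eps t -> has_type p q (w t v)) ->
  has_type p q (ext_deriv0 w v).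
Proof.
move=> eps0 tw S; rewrite ffunE => wS.
have [[-> ->]//|nS] := eqVneq (#|(S :&: dz_indices n)%SET|,
  #|(S :\: dz_indices n)%SET|) (p, q).
case/eqP: wS; apply: has_deriv0_deriv0; apply: has_deriv0_near (has_deriv0_cst 0).
apply: filterS (near0_base eps0) => t bt.
by rewrite (has_type_coef0 (tw t bt) nS).
Qed.

(** The term of the first-order expansion that comes from the dzbar's trades one
    of them for a dz, so it does not mix with the other two. *)
Lemma has_type_iota_vbar_split (R : realType) (n p q : nat) (B : 'M[R[i]]_n)
    (a : ext R (n + n)) : (0 < q)%N -> has_type p q a ->
  has_type p.+1 q.-1 (\sum_(S : {set 'I_(n + n)}) a S *:
    wedge (ebasis (S :&: dz_indices n)%SET)
          (iota_vbar B (ebasis (S :\: dz_indices n)%SET))).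
Proof.
move=> q0 ta; apply: has_type_sum => S; apply: has_typeZ => aS.
have [cp cq] := ta S aS; rewrite -addn1 -(add0n q.-1).
apply: has_type_wedge.
  have := @has_type_ebasis R n (S :&: dz_indices n)%SET.
  by rewrite -finset.setIA finset.setIid cp finset.setDIl finset.setDv
    finset.setI0 cards0.
apply: has_type_iota_vbar; rewrite prednK//.
have := @has_type_ebasis R n (S :\: dz_indices n)%SET.
by rewrite finset.setIDAC finset.setDIl finset.setDv finset.setI0 cards0
  finset.setDDl finset.setUid cq.
Qed.

Theorem theorem1p3 (R : realType) (n p : nat) (hp : (1 < p)%N)
  (hpn : (p < n - 1)%N)
  (M : cmanifold R n) (M_compact : compact [set: M])
  (Omega0 : preform M) (Omega0_kahler : p_kahler p Omega0)
  (eps : R) (eps_gt0 : 0 < eps)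
  (X : dfamily n eps) (Psi : trivialization M X)
  (phi : R -> prevform M) (phi_param : parametrized_by Psi phi)
  (Omega_ : forall t : R, preform (fibre X t))
  (Omega_transverse : forall t, base eps t -> real_transverse_form p (Omega_ t))
  (Omega_smooth : smooth_family eps (fun t => on_M Psi (Omega_ t)))
  (Omega_0 : form_eq (on_M Psi (Omega_ 0)) Omega0)
  (Omega : R -> preform M)
  (Omega_pp : forall t, base eps t -> pq_form p p (Omega t))
  (Omega_family : smooth_family eps Omega)
  (Omega_ext : forall t, base eps t -> forall c, hol_chart c ->
     forall u, cimg c u ->
     on_M Psi (Omega_ t) c u = ext_exp (phi t c u) (Omega t c u))
  (Omega_kahler : forall t, base eps t -> p_kahler p (Omega_ t)) :
  forall c, hol_chart c -> forall u, cimg c u ->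
    del (fun v => iota_v (vform_deriv0 phi c v) (Omega0 c v)) u =
    - delbar (form_deriv0 Omega c) u.
Proof.
move=> c hc u cu.
have [_ phi_smooth phi0 _ _] := phi_param.
have sc := hol_chart_smooth hc.
have oc : open (cimg c) by have [[]] := hc.
have b0 : base eps 0 by exact: base0.
have n0 : (0 < n)%N by lia.
pose a v := iota_v (vform_deriv0 phi c v) (Omega0 c v).
pose b := ext_deriv0 (fun t => Omega t c).
pose w t := on_M Psi (Omega_ t) c.
have Omega0E v : cimg c v -> Omega 0 c v = Omega0 c v.
  by move=> cv; rewrite -Omega_0// (Omega_ext 0 b0)// phi0// ext_exp0.
have tOmega t v : base eps t -> cimg c v -> has_type p p (Omega t c v).
  by move=> bt cv; exact: (Omega_pp t bt).2.
have tb v : cimg c v -> has_type p p (b v).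
  by move=> cv; apply: has_type_ext_deriv0 eps_gt0 _ => t bt; exact: tOmega.
have ta v : cimg c v -> has_type p.-1 p.+1 (a v).
  move=> cv; apply: has_type_iota_v; rewrite prednK; last by lia.
  by rewrite -Omega0E//; exact: tOmega.
have dw : ext_d (ext_deriv0 w) u = 0.
  apply: (ext_d_ext_deriv0 eps_gt0 oc _ cu) => [S|t bt].
    exact: Omega_smooth.
  exact: ext_d_on_M bt (Omega_kahler t bt).2 sc cu.
have tw v : cimg c v -> exists2 e, has_type p.+1 p.-1 e &
    ext_deriv0 w v = b v + (a v + e).
  move=> cv.
  have dphi l k : has_deriv0 (fun t => phi t c v l k) (vform_deriv0 phi c v l k).
    rewrite mxE.
    exact: (has_deriv0_family (f := fun t v => phi t c v l k) eps_gt0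
      (phi_smooth c hc l k) cv).
  have dOmega : has_ext_deriv0 (fun t => Omega t c v) (b v).
    by apply: has_ext_deriv0_family eps_gt0 _ _ cv => S; exact: Omega_family.
  have D := has_ext_deriv0_ext_exp n0 (phi0 c hc v cv) dphi dOmega.
  eexists; last first.
    apply/ffunP => S; rewrite [LHS]ffunE.
    have N : \forall t \near 0, ext_exp (phi t c v) (Omega t c v) S = w t v S.
      apply: filterS (near0_base eps_gt0) => t bt.
      by rewrite -(Omega_ext t bt).
    rewrite (has_deriv0_deriv0 (has_deriv0_near N (D S))).
    by rewrite (Omega0E v cv).
  by apply: has_type_iota_vbar_split; [lia|rewrite -Omega0E//; exact: tOmega].
apply/eqP; rewrite -addr_eq0; apply/eqP/ffunP => T; rewrite [RHS]ffunE.
have [tT|nT] := eqVneq (#|(T :&: dz_indices n)%SET|,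
  #|(T :\: dz_indices n)%SET|) (p, p.+1).
  have := ext_d_component oc cu ta tb tw (ltnW hp) tT.
  by rewrite dw ffunE ffunE => <-.
have t1 : has_type p p.+1 (del a u).
  have := has_type_del oc cu ta; rewrite prednK//; lia.
have t2 : has_type p p.+1 (delbar b u) := has_type_delbar oc cu tb.
by rewrite ffunE (has_type_coef0 t1 nT) (has_type_coef0 t2 nT) addr0.
Qed.
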